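(* Let $\varphi$ be an automorphism of an infinite subshift $(X,\sigma)$. Let $K$ be the subgroup of $H(X)$ generated by $\{\sigma,\varphi\}$. For $F\subset K$ let $\Lambda(F)=\{(i,j)\in\mathbb Z^2:\varphi^i\sigma^j\in F\}$. Then: (1) A subset of $\mathbb Z^2$ is of the form $\mathcal C\cap\mathbb Z^2$, where $\mathcal C$ is a connected component of $\mathcal E(\varphi)=\mathcal E_R(\varphi)\cap\mathcal E_L(\varphi)$, if and only if it is of the form $\Lambda(C^\circ)$, where $C^\circ$ is the interior of an essentially-weakly-LR cone $C$ in $K$. (2) A subset of $\mathbb Z^2$ is of the form $\mathcal D\cap\mathbb Z^2$, where $\mathcal D$ is a connected component of $\mathcal E_R(\varphi)\cup\mathcal E_L(\varphi)$ such that $\mathcal D\cap\mathcal E(\varphi)\ne\emptyset$, if and only if it is of the form $\Lambda((D^* )^\circ)$, where $(D^* )^\circ$ is the interior of an extended district $D^*$ in $K$.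
   Context: **Subshifts.** An alphabet is a finite set with at least two elements. For an alphabet $A$, $A^{\mathbb Z}$ carries the product topology; the shift maps $(a_j)_j$ to $(a_{j+1})_j$. A subshift $(X,\sigma)$ over $A$ is a closed $X\subset A^{\mathbb Z}$ with $\sigma(X)=X$, $\sigma$ being the restricted shift; $d_X$ is a compatible metric. $H(X)$ is the group of homeomorphisms of $X$. An automorphism of $(X,\tau)$ is a homeomorphism of $X$ commuting with $\tau$. A homeomorphism $\tau$ is expansive if there is $\delta>0$ such that $d_X(\tau^j(x),\tau^j(y))\le\delta$ for all $j\in\mathbb Z$ implies $x=y$. For commuting homeomorphisms $\psi,\tau$ of $X$, $\psi$ is left (resp. right) $\tau$-expansive if there is $\delta>0$ such that $d_X(\tau^j\psi^i(x),\tau^j\psi^i(y))\le\delta$ for all $i\in\mathbb Z$ and all $j\le0$ (resp. $j\ge0$) implies $x=y$. **Resolving automorphisms.** A graph is a finite directed graph $G$ (multiple arcs, loops allowed) with arc-set $A_G$, vertex-set $V_G$ and initial/terminal vertex maps $i_G,t_G$; $X_G\subset A_G^{\mathbb Z}$ is the set of bi-infinite paths. A graph-homomorphism $h=(h_A,h_V):\Gamma\to G$ is a pair of maps on arcs and vertices compatible with $i,t$; it induces $\phi_h:X_\Gamma\to X_G$, $(\alpha_j)\mapsto(h_A(\alpha_j))$. $h$ is weakly left-resolving (resp. weakly right-resolving) if every arc $\alpha$ of $\Gamma$ is uniquely determined by $t_\Gamma(\alpha)$ (resp. $i_\Gamma(\alpha)$) and $h_A(\alpha)$. A textile system $T=(p,q:\Gamma\to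 G)$ is a pair of graph-homomorphisms; it is weakly $p$-L if $p$ is weakly left-resolving, weakly $q$-R if $q$ is weakly right-resolving, weakly LR if both. For $\mathcal P\in\{p\text{-L},q\text{-R},\text{LR}\}$, an endomorphism $\varphi'$ of a subshift $(X',\sigma')$ is weakly $\mathcal P$ if there are a weakly $\mathcal P$ textile system $(p,q:\Gamma\to G)$ and a closed shift-invariant $Z\subset X_\Gamma$ such that $\phi_p|_Z$ is injective, $\phi_p(Z)=X'$, $\phi_q(Z)\subset X'$ and $\varphi'=\phi_q\circ(\phi_p|_Z)^{-1}$. An automorphism $\psi$ of $(X,\tau)$ ($\tau$ a homeomorphism) is essentially weakly $\mathcal P$ if there are a subshift $(X',\sigma')$, a weakly $\mathcal P$ endomorphism $\varphi'$ of it and a homeomorphism $\theta:X\to X'$ with $\theta\tau=\sigma'\theta$, $\theta\psi=\varphi'\theta$. **Cones and extended districts.** Let $E(K)$ be the set of expansive elements of $K$. An essentially-weakly-LR cone in $K$ is a set $C=C_K(\tau)=\{\psi\in K:\psi\text{ is an essentially weakly LR automorphism of }(X,\tau)\}$ for some $\tau\in E(K)$; its interior is $C^\circ=C\cap E(K)$. For $\psi,\tau\in K$ write $\psi\multimap\tau$ if $\tau$ is expansive and $\psi$ is an essentially weakly $p$-L or an essentially weakly $q$-R automorphism of $(X,\tau)$; write $\psi\multimap^\circ\tau$ if $\tau$ is expansive and $\psi$ is either an essentially weakly $p$-L and right $\tau$-expansive automorphism of $(X,\tau)$ or an essentially weakly $q$-R and left $\tau$-expansive automorphism of $(X,\tau)$.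 For $\tau\in E(K)$, the extended district $D_K^*(\tau)$ is the set of $\psi\in K$ for which there are $r\ge1$ and $\tau_1,\dots,\tau_r\in E(K)$ with $\psi\multimap\tau_1\multimap\cdots\multimap\tau_r=\tau$; its interior $(D_K^* )^\circ(\tau)$ is the set of $\psi\in K$ for which there are $r\ge1$ and $\tau_1,\dots,\tau_r\in E(K)$ with $\psi\multimap^\circ\tau_1\multimap^\circ\cdots\multimap^\circ\tau_r=\tau$ (this depends only on the set $D_K^*(\tau)$). An extended district in $K$ is a set $D_K^*(\tau)$, $\tau\in E(K)$. **Expansive sets in the plane.** $r\in\mathbb R$ is a left (resp. right) $\sigma$-expansive direction for $\varphi$ if there is $\delta>0$ such that for $x,y\in X$, $d_X(\sigma^j\varphi^i(x),\sigma^j\varphi^i(y))\le\delta$ for all $(i,j)\in\mathbb Z^2$ with $j\le ri$ (resp. $j\ge ri$) implies $x=y$. $E_L(\varphi),E_R(\varphi)\subset\mathbb R$ are the sets of left, resp. right, $\sigma$-expansive directions, and $\mathcal E_L(\varphi)=\{(a,b)\in\mathbb R^2\setminus\{(0,0)\}: a=0 \text{ or } b/a\in E_L(\varphi)\}$, $\mathcal E_R(\varphi)=\{(a,b)\in\mathbb R^2\setminus\{(0,0)\}: a=0\text{ or } b/a\in E_R(\varphi)\}$. *)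

(* Defs.v *)
From HB Require Import structures.
From mathcomp Require Import all_boot all_order all_algebra.
From mathcomp Require Import all_classical all_reals all_analysis.

Set Implicit Arguments.
Unset Strict Implicit.
Unset Printing Implicit Defensive.
Import Order.TTheory GRing.Theory Num.Theory.
Import numFieldNormedType.Exports.
Local Open Scope classical_set_scope.
Local Open Scope ring_scope.

Record homeo (S T : topologicalType) := Homeo {
  homeo_fun :> S -> T;
  homeo_inv : T -> S;
  homeo_funK : cancel homeo_fun homeo_inv;
  homeo_invK : cancel homeo_inv homeo_fun;
  homeo_continuous : continuous homeo_fun;
  homeo_inv_continuous : continuous homeo_inv }.

Lemma homeo_ext (S T : topologicalType) (f g : homeo S T) : f =1 g -> f = g.
Proof.
case: f => f f' fK f'K cf cf'; case: g => g g' gK g'K cg cg' /= fg.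
have {}fg : f = g by apply/funext.
have fg' : f' = g' by apply/funext=> y; rewrite -[in LHS](g'K y) -fg fK.
by case: _ / fg in gK g'K cg *; case: _ / fg' in gK g'K cg' *;
   congr Homeo; exact: Prop_irrelevance.
Qed.

HB.instance Definition _ (S T : topologicalType) := gen_eqMixin (homeo S T).
HB.instance Definition _ (S T : topologicalType) := gen_choiceMixin (homeo S T).

Section HomeoGroup.
Context {T : topologicalType}.
Implicit Types f g h : homeo T T.

Definition homeo_id : homeo T T :=
  @Homeo T T id id (fun=> erefl) (fun=> erefl) (fun=> cvg_id) (fun=> cvg_id).

Definition homeo_sym f : homeo T T :=
  Homeo (@homeo_invK _ _ f) (@homeo_funK _ _ f)
    (@homeo_inv_continuous _ _ f) (@homeo_continuous _ _ f).

Lemma homeo_comp_continuous f g : continuous (f \o g).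
Proof.
by move=> x; apply: continuous_comp; exact: homeo_continuous.
Qed.

Lemma homeo_comp_inv_continuous f g : continuous (homeo_inv g \o homeo_inv f).
Proof.
by move=> x; apply: continuous_comp; exact: homeo_inv_continuous.
Qed.

Definition homeo_comp f g : homeo T T :=
  @Homeo T T (f \o g) (homeo_inv g \o homeo_inv f)
    (can_comp (@homeo_funK _ _ f) (@homeo_funK _ _ g))
    (can_comp (@homeo_invK _ _ g) (@homeo_invK _ _ f))
    (@homeo_comp_continuous f g) (@homeo_comp_inv_continuous f g).

Lemma homeo_compA : associative homeo_comp.
Proof. by move=> f g h; exact: homeo_ext. Qed.

Lemma homeo_comp_id : left_id homeo_id homeo_comp.
Proof. by move=> f; exact: homeo_ext. Qed.

Lemma homeo_id_comp : right_id homeo_id homeo_comp.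
Proof. by move=> f; exact: homeo_ext. Qed.

Lemma homeo_comp_sym : left_inverse homeo_id homeo_sym homeo_comp.
Proof. by move=> f; apply: homeo_ext => x /=; rewrite homeo_funK. Qed.

Lemma homeo_sym_comp : right_inverse homeo_id homeo_sym homeo_comp.
Proof. by move=> f; apply: homeo_ext => x /=; rewrite homeo_invK. Qed.

End HomeoGroup.

(* [(f * g)%g] is the composite [f \o g]. *)
HB.instance Definition _ (T : topologicalType) :=
  isGroup.Build (homeo T T) (@homeo_compA T) (@homeo_comp_id T)
    (@homeo_id_comp T) (@homeo_comp_sym T) (@homeo_sym_comp T).

Definition expgz (G : groupType) (g : G) (n : int) : G :=
  match n with
  | Posz m => (g ^+ m)%g
  | Negz m => (g ^- m.+1)%g
  end.

Definition generated_subgroup (G : groupType) (S : set G) : set G :=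
  smallest [set K : set G | group_closed [in K]] S.

Definition automorphism (T : topologicalType) (tau psi : homeo T T) : Prop :=
  commute psi tau.

Notation fullshift A := {ptws int -> discrete_topology A}.

Definition shift (A : finType) (a : fullshift A) : fullshift A :=
  fun j : int => a (j + 1).

Record subshift (A : finType) := Subshift {
  subshift_set :> set (fullshift A);
  subshift_alphabet : (1 < #|A|)%N;
  subshift_closed : closed subshift_set;
  subshift_shift : @shift A @` subshift_set = subshift_set }.

Lemma prod_topology_continuous (I : Type) (K : I -> topologicalType)
    (Y : topologicalType) (f : Y -> prod_topology K) :
  (forall i, continuous (fun y => f y i)) -> continuous f.
Proof.
move=> cf y; apply/cvg_sup => i; move: y.
apply/(@continuousP _ (initial_topology (@^~ i))) => _ [B oB <-].
by have /continuousP/(_ _ oB) := cf i.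
Qed.

Section SubshiftMap.
Context {A : finType}.

Lemma reindex_continuous (h : int -> int) :
  continuous ((fun a j => a (h j)) : fullshift A -> fullshift A).
Proof.
apply: (@prod_topology_continuous int (fun=> discrete_topology A)) => i.
exact: (@proj_continuous _ (fun=> discrete_topology A) (h i)).
Qed.

Definition unshift (a : fullshift A) : fullshift A := fun j : int => a (j - 1).

Lemma shiftK : cancel (@shift A) unshift.
Proof. by move=> a; apply/funext => j; rewrite /shift /unshift subrK. Qed.

Lemma unshiftK : cancel unshift (@shift A).
Proof. by move=> a; apply/funext => j; rewrite /shift /unshift addrK. Qed.

Lemma shift_continuous : continuous (@shift A).
Proof. exact: reindex_continuous. Qed.

Lemma unshift_continuous : continuous unshift.
Proof. exact: reindex_continuous. Qed.

Variable X : subshift A.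

Lemma shift_in (x : X) : shift (\val x) \in (X : set _).
Proof.
apply/mem_set; rewrite -[X in X _]subshift_shift.
by exists (\val x) => //; exact: set_valP.
Qed.

Lemma unshift_in (x : X) : unshift (\val x) \in (X : set _).
Proof.
apply/mem_set; have := set_valP x; rewrite -[X in X _ -> _]subshift_shift.
by case=> a Xa <-; rewrite shiftK.
Qed.

Definition subshift_fun (x : X) : X := exist _ (shift (\val x)) (shift_in x).
Definition subshift_inv (x : X) : X := exist _ (unshift (\val x)) (unshift_in x).

Lemma subshift_funK : cancel subshift_fun subshift_inv.
Proof. by move=> x; apply: val_inj; rewrite /= shiftK. Qed.

Lemma subshift_invK : cancel subshift_inv subshift_fun.
Proof. by move=> x; apply: val_inj; rewrite /= unshiftK. Qed.

Lemma subshift_fun_continuous : continuous subshift_fun.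
Proof.
apply: continuous_comp_initial => x.
apply: (@continuous_comp _ _ _ set_val (@shift A)); first exact: initial_continuous.
exact: shift_continuous.
Qed.

Lemma subshift_inv_continuous : continuous subshift_inv.
Proof.
apply: continuous_comp_initial => x.
apply: (@continuous_comp _ _ _ set_val (unshift)); first exact: initial_continuous.
exact: unshift_continuous.
Qed.

End SubshiftMap.

Definition sigma (A : finType) (X : subshift A) : homeo X X :=
  Homeo (@subshift_funK A X) (@subshift_invK A X)
    (@subshift_fun_continuous A X) (@subshift_inv_continuous A X).

Definition compatible_metric (R : realType) (T : topologicalType)
    (d : T -> T -> R) : Prop :=
  [/\ forall x y, 0 <= d x y,
      forall x y, d x y = 0 <-> x = y,
      forall x y, d x y = d y x,
      forall x y z, d x z <= d x y + d y z &
      forall x (U : set T),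
        nbhs x U <-> exists2 e : R, 0 < e & [set y | d x y < e] `<=` U].

Section Expansive.
Context {R : realType} {T : topologicalType} (d : T -> T -> R).
Implicit Types (tau psi phi : homeo T T) (r : R).

Definition expansive tau : Prop :=
  exists2 delta : R, 0 < delta & forall x y : T,
    (forall j : int, d (expgz tau j x) (expgz tau j y) <= delta) -> x = y.

Definition left_expansive tau psi : Prop :=
  exists2 delta : R, 0 < delta & forall x y : T,
    (forall i j : int, j <= 0 ->
      d (expgz tau j (expgz psi i x)) (expgz tau j (expgz psi i y)) <= delta) ->
    x = y.

Definition right_expansive tau psi : Prop :=
  exists2 delta : R, 0 < delta & forall x y : T,
    (forall i j : int, 0 <= j ->
      d (expgz tau j (expgz psi i x)) (expgz tau j (expgz psi i y)) <= delta) ->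
    x = y.

Definition left_direction tau phi : set R := [set r |
  exists2 delta : R, 0 < delta & forall x y : T,
    (forall i j : int, j%:~R <= r * i%:~R ->
      d (expgz tau j (expgz phi i x)) (expgz tau j (expgz phi i y)) <= delta) ->
    x = y].

Definition right_direction tau phi : set R := [set r |
  exists2 delta : R, 0 < delta & forall x y : T,
    (forall i j : int, r * i%:~R <= j%:~R ->
      d (expgz tau j (expgz phi i x)) (expgz tau j (expgz phi i y)) <= delta) ->
    x = y].

Definition plane_left tau phi : set (R * R) := [set ab |
  ab <> (0, 0) /\ (ab.1 = 0 \/ left_direction tau phi (ab.2 / ab.1))].

Definition plane_right tau phi : set (R * R) := [set ab |
  ab <> (0, 0) /\ (ab.1 = 0 \/ right_direction tau phi (ab.2 / ab.1))].

End Expansive.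

(* A finite directed graph with arc-set [A]: bi-infinite paths are points of the
   full shift over [A]. *)
Record graph (A : finType) := Graph {
  vertex : finType;
  ini : A -> vertex;
  ter : A -> vertex }.

Definition paths (A : finType) (G : graph A) : set (fullshift A) :=
  [set a | forall j : int, ter G (a j) = ini G (a (j + 1))].

Record graph_hom (B A : finType) (Gamma : graph B) (G : graph A) := GraphHom {
  arc_map : B -> A;
  vertex_map : vertex Gamma -> vertex G;
  arc_map_ini : forall b, ini G (arc_map b) = vertex_map (ini Gamma b);
  arc_map_ter : forall b, ter G (arc_map b) = vertex_map (ter Gamma b) }.

Section GraphHom.
Context {B A : finType} {Gamma : graph B} {G : graph A}.
Implicit Types h p q : graph_hom Gamma G.

Definition path_map h (b : fullshift B) : fullshift A :=
  fun j : int => arc_map h (b j).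

Definition weakly_left_resolving h : Prop :=
  injective (fun b : B => (ter Gamma b, arc_map h b)).

Definition weakly_right_resolving h : Prop :=
  injective (fun b : B => (ini Gamma b, arc_map h b)).

End GraphHom.

Variant resolving := PL | QR | LR.

Definition weakly_textile (P : resolving) (B A : finType) (Gamma : graph B)
    (G : graph A) (p q : graph_hom Gamma G) : Prop :=
  match P with
  | PL => weakly_left_resolving p
  | QR => weakly_right_resolving q
  | LR => weakly_left_resolving p /\ weakly_right_resolving q
  end.

Definition endomorphism (A : finType) (X : subshift A) (f : X -> X) : Prop :=
  continuous f /\ f \o sigma X = sigma X \o f.

(* [phi_p(Z) = X] makes the points of [X] sequences of arcs of [G], whence the
   arc-set of [G] is the alphabet of [X]. *)
Definition weakly_endomorphism (P : resolving) (A : finType) (X : subshift A)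
    (f : X -> X) : Prop :=
  endomorphism f /\
  exists (G : graph A) (B : finType) (Gamma : graph B)
         (p q : graph_hom Gamma G) (Z : set (fullshift B)),
    [/\ weakly_textile P p q,
        [/\ closed Z, Z `<=` paths Gamma & @shift B @` Z = Z],
        set_inj Z (path_map p) /\ path_map p @` Z = X,
        path_map q @` Z `<=` X &
        forall (x : X) z, Z z -> path_map p z = \val x ->
          \val (f x) = path_map q z].

Definition ess_weakly (P : resolving) (T : topologicalType)
    (tau psi : homeo T T) : Prop :=
  automorphism tau psi /\
  exists (A : finType) (X : subshift A) (f : X -> X) (theta : homeo T X),
    [/\ weakly_endomorphism P f,
        theta \o tau = sigma X \o theta &
        theta \o psi = f \o theta].

Section Cones.
Context {R : realType} {T : topologicalType} (d : T -> T -> R).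
Variable K : set (homeo T T).
Implicit Types (tau psi : homeo T T) (C D : set (homeo T T)).

Definition expansive_elements : set (homeo T T) := K `&` expansive d.

Definition cone tau : set (homeo T T) := [set psi | K psi /\ ess_weakly LR tau psi].

Definition is_cone C : Prop := exists2 tau, expansive_elements tau & C = cone tau.

Definition cone_interior C : set (homeo T T) := C `&` expansive_elements.

Definition arrow psi tau : Prop :=
  expansive d tau /\ (ess_weakly PL tau psi \/ ess_weakly QR tau psi).

Definition strict_arrow psi tau : Prop :=
  expansive d tau /\
  (ess_weakly PL tau psi /\ right_expansive d tau psi \/
   ess_weakly QR tau psi /\ left_expansive d tau psi).

(* [psi -> t 1 -> ... -> t r = tau] with [1 <= r]. *)
Definition chain (arr : homeo T T -> homeo T T -> Prop) psi tau : Prop :=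
  exists (r : nat) (t : nat -> homeo T T),
    [/\ (0 < r)%N, t 0%N = psi, t r = tau,
        forall i, (0 < i <= r)%N -> expansive_elements (t i) &
        forall i, (i < r)%N -> arr (t i) (t i.+1)].

Definition district tau : set (homeo T T) := [set psi | K psi /\ chain arrow psi tau].

Definition strict_district tau : set (homeo T T) :=
  [set psi | K psi /\ chain strict_arrow psi tau].

(* The interior is computed from a representative [tau] of [D], but it depends
   only on [D]. *)
Definition district_interior D D0 : Prop :=
  exists tau, [/\ expansive_elements tau, D = district tau &
                  D0 = strict_district tau].

End Cones.

Definition component (T : topologicalType) (S C : set T) : Prop :=
  (connected_component S @` S) C.

Definition lattice_points (R : realType) (C : set (R * R)) : set (int * int) :=
  [set ij | C (ij.1%:~R, ij.2%:~R)].

Definition Lambda (T : topologicalType) (tau phi : homeo T T)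
    (F : set (homeo T T)) : set (int * int) :=
  [set ij | F (expgz phi ij.1 * expgz tau ij.2)%g].

(* Main.v *)
(* Write alpha^u = phi^i sigma^j for u = (i, j), and say that a normal n codes if
   the symbols of alpha^u x at 0, for u in the half-plane n.u <= 0, determine x.
   A direction is expansive on one side when one of its two normals codes, and
   on both sides when both do.

   If every normal n with n.w <= 0 <= n.v codes, then for a large disc B the
   patterns of x on B, B + w and B + v + w determine the one on B + v: the points
   of B + v outside the three discs lie next to boundary points whose outer
   normals are close to this cone, and coding is an open condition, uniform by
   compactness. So alpha^v is given over (X, alpha^w) by a weakly p-L textile
   system of 2 x 2 blocks of disc patterns; the opposite cone gives q-R, and both
   cones give LR.  Conversely a weakly p-L system makes right rays propagate, so
   each half-plane with n.w < 0 < n.v, which contains rays arbitrarily far back,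
   codes.

   Hence the arrows between expansive elements follow segments of the plane on
   which one fixed side codes, and a path in E_R | E_L splits into such segments
   at lattice points of E. *)
Require Import Defs.
From mathcomp Require Import all_boot all_order all_algebra.
From mathcomp Require Import all_classical all_reals all_analysis.
From mathcomp Require Import ring lra zify.
From mathcomp Require finmap.
Set Implicit Arguments.
Unset Strict Implicit.
Unset Printing Implicit Defensive.
Import Order.TTheory GRing.Theory Num.Theory.
Import numFieldNormedType.Exports.
Local Open Scope classical_set_scope.
Local Open Scope ring_scope.

(** Ray propagation handles only the normals with n.w < 0 < n.v. Those with n.w = 0 come from
    expansiveness of alpha^w, and those with n.v = 0 from the one-sided expansiveness in a strict
    arrow; this is why strict arrows match the open planar sets. Infinitude of X excludes opposite
    vectors: if alpha^v pushes a ray of alpha^w backwards, one ray determines the point, and then X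
    is finite. So an arrow never makes a half-turn, although a component of E_R | E_L may contain
    both w and a negative multiple of w; such a pair is joined through a third vector off their
    line. Discs are used, not polygons adapted to v and w, because one shape then has outer normals
    in every direction and the same radius serves both corners of a textile block. Agreement on
    discs is also the common language of the metric and the symbols: compactness trades a constant
    delta for a radius r. *)

(** * Compactness and locally constant maps *)

Lemma compact_uniform (U : topologicalType) (K : set U) (P : nat -> U -> Prop) :
  compact K -> (forall m n x, (m <= n)%N -> P m x -> P n x) ->
  (forall x, K x -> exists n, \forall x' \near x, P n x') ->
  exists n, forall x, K x -> P n x.
Proof.
move=> /compact_near_coveringP cK mono loc.
have [|n _ /(_ n (leqnn n)) Kn] := cK nat \oo P _; last by exists n.
move=> x /loc [n Pn]; exists (P n, [set i | (n <= i)%N]) => /=.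
  by split=> //; exists n.
by case=> y i [/= Py ni]; exact: (mono n).
Qed.

Definition locally_constant (T : topologicalType) (F : Type) (f : T -> F) : Prop :=
  forall x, \forall y \near x, f y = f x.

Lemma locally_constant_comp (S T : topologicalType) (F : Type) (f : T -> F)
    (g : S -> T) :
  locally_constant f -> continuous g -> locally_constant (f \o g).
Proof. by move=> lf cg x; exact: (cg x _ (lf (g x))). Qed.

Lemma locally_constant_map (T : topologicalType) (F : Type) (I : Type)
    (f : I -> T -> F) (s : seq I) :
  (forall i, locally_constant (f i)) ->
  locally_constant (fun x => [seq f i x | i <- s]).
Proof.
move=> lf x; elim: s => [|i s ih] /=; first exact: nearW.
by near=> y; congr cons; near: y => //; exact: lf.
Unshelve. all: by end_near. Qed.

Lemma locally_constant_near2 (T : topologicalType) (F : Type) (f : T -> F) (z : T * T) :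
  locally_constant f -> \forall y \near z, f y.1 = f z.1 /\ f y.2 = f z.2.
Proof.
move=> lf; near=> y; split; near: y.
  exact: (@cvg_fst _ _ _ _ _ _ (lf z.1)).
exact: (@cvg_snd _ _ _ _ _ _ (lf z.2)).
Unshelve. all: by end_near. Qed.

(** A pair with [g x <> g y] is told apart by some [f j] with [J j], and so are all pairs near it;
    compactness of the square of [K] bounds the [|j|] that are needed. *)
Lemma finite_window (S : topologicalType) (K : set S) (F H : Type) (J : set int)
    (f : int -> S -> F) (g : S -> H) :
  compact K -> (forall j, locally_constant (f j)) -> locally_constant g ->
  (forall x y, K x -> K y -> (forall j, J j -> f j x = f j y) -> g x = g y) ->
  exists N : nat, forall x y, K x -> K y ->
    (forall j, J j -> `|j| <= N%:Z -> f j x = f j y) -> g x = g y.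
Proof.
move=> cK lf lg fg.
have [||N HN] := compact_uniform (P := fun N (z : S * S) =>
    (forall j, J j -> `|j| <= N%:Z -> f j z.1 = f j z.2) -> g z.1 = g z.2)
    (compact_setX cK cK).
- by move=> i k z ik hi hk; apply: hi => j Jj ji; apply: hk => //; lia.
- move=> z [K1 K2]; have [gz|gz] := pselect (g z.1 = g z.2).
    exists 0%N; apply: filterS (locally_constant_near2 z lg) => z' [e1 e2] _.
    by rewrite e1 e2.
  have [j [Jj nj]] : exists j, J j /\ f j z.1 <> f j z.2.
    apply: contrapT => h; apply: gz; apply: fg => // j Jj.
    by apply: contrapT => nj; apply: h; exists j.
  exists `|j|%N; apply: filterS (locally_constant_near2 z (lf j)) => z' [e1 e2] h.
  by exfalso; apply: nj; rewrite -e1 -e2; apply: h => //; lia.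
by exists N => x y Kx Ky; exact: (HN (x, y)).
Qed.

(** * Powers and the lattice action *)

Section IntegerPowers.
Local Open Scope group_scope.
Variable G : groupType.
Implicit Types (g h : G) (i j : int).

Lemma expgz_comm g h j : commute g h -> commute g (expgz h j).
Proof.
by case: j => n gh; [exact: commuteX | exact/commuteV/commuteX].
Qed.

Lemma expgzN g j : expgz g (- j) = (expgz g j)^-1.
Proof.
by case: j => [[|n]|n] //=; rewrite ?invg1 ?invgK.
Qed.

Lemma expgzS g j : expgz g (j + 1)%R = g * expgz g j.
Proof.
case: j => [n|[|n]].
- by rewrite (_ : (Posz n + 1)%R = Posz n.+1); [rewrite /= expgS | lia].
- by rewrite /= expg1 mulgV.
- rewrite (_ : (Negz n.+1 + 1)%R = Negz n); last lia.
  by rewrite /= [g ^+ n.+2]expgSr invgM mulgA mulgV mul1g.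
Qed.

Lemma expgzD g i j : expgz g (i + j)%R = expgz g i * expgz g j.
Proof.
elim/int_rec: i => [|n ih|n ih]; first by rewrite add0r mul1g.
  rewrite -addn1 PoszD -addrA [(1 + j)%R]addrC addrA expgzS ih expgzS.
  by rewrite mulgA.
apply: (mulgI g); rewrite -expgzS mulgA -expgzS.
rewrite (_ : - n.+1%:Z + j + 1 = - n%:Z + j)%R; last lia.
by rewrite ih; congr (expgz _ _ * _); lia.
Qed.

End IntegerPowers.

Section LatticeAction.
Local Open Scope group_scope.
Context {G : groupType} (s p : G).
Hypothesis sp : commute p s.
Implicit Types (u v w : int * int).

Definition act u : G := expgz p u.1 * expgz s u.2.

Lemma actD u v : act (u + v)%R = act u * act v.
Proof.
rewrite /act /= !expgzD !mulgA; congr (_ * _).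
rewrite -!mulgA; congr (_ * _); apply/commute_sym/expgz_comm/commute_sym.
exact/expgz_comm/sp.
Qed.

Lemma act0 : act 0%R = 1. Proof. by rewrite /act /= mulg1. Qed.

Lemma actN u : act (- u)%R = (act u)^-1.
Proof. by apply: (mulgI (act u)); rewrite -actD subrr mulgV act0. Qed.

Lemma actC u v : commute (act u) (act v).
Proof. by rewrite /commute -!actD addrC. Qed.

Lemma actM w j : expgz (act w) j = act (w *~ j)%R.
Proof.
case: j => n; rewrite /= ?NegzE ?mulrNz ?actN.
  by elim: n => [|n ih]; rewrite ?mulr0z ?act0 // expgS ih -actD -mulrS.
congr (_^-1).
by elim: n.+1 => [|k ih]; rewrite ?mulr0z ?act0 // expgS ih -actD -mulrS.
Qed.

Lemma act_vertical j : act (0, j) = expgz s j.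
Proof. by rewrite /act /= mul1g. Qed.

Lemma generated_act (K : set G) :
  K = generated_subgroup [set s; p] -> forall g, K g <-> exists u, g = act u.
Proof.
move=> -> g; split.
  suff: generated_subgroup [set s; p] `<=` [set h | exists u, h = act u] by apply.
  apply: smallest_sub => /=; last first.
    move=> h [->|->]; [exists (0%Z, 1%Z)|exists (1%Z, 0%Z)]; by rewrite /act /= ?mul1g ?mulg1 expg1.
  split; first by apply/mem_set; exists 0%R; rewrite act0.
  move=> _ _ /set_mem[u ->] /set_mem[v ->].
  by apply/mem_set; exists (u - v)%R; rewrite actD actN.
move=> [u ->] H [Hg sub].
have Hs : s \in H by apply/mem_set/sub; left.
have Hp : p \in H by apply/mem_set/sub; right.
have HX h n : h \in H -> h ^+ n \in H.
  move=> Hh; elim: n => [|n ih]; first by rewrite expg0; case: Hg.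
  by rewrite expgS; apply: (group_closedM Hg).
have HZ h j : h \in H -> expgz h j \in H.
  by move=> Hh; case: j => n /=; [exact: HX | exact/(group_closedV Hg)/HX].
by apply/set_mem/(group_closedM Hg); exact: HZ.
Qed.

End LatticeAction.

(** * Subshifts and textile systems *)

Lemma locally_constant_hausdorff (T : topologicalType) (I F : Type) (f : I -> T -> F) :
  (forall i, locally_constant (f i)) -> (forall x y, (forall i, f i x = f i y) -> x = y) ->
  hausdorff_space T.
Proof.
move=> lf sep x y xy; apply: sep => i.
by have [z [<- <-]] := xy _ _ (lf i x) (lf i y).
Qed.

Lemma homeo_of_bijection (S T : topologicalType) (f : S -> T) :
  compact [set: S] -> hausdorff_space T -> continuous f -> injective f ->
  (forall y, exists x, f x = y) -> exists h : homeo S T, forall x, h x = f x.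
Proof.
move=> cS hT cf injf surjf.
pose g y := projT1 (cid (surjf y)).
have gK : cancel g f by move=> y; exact: (projT2 (cid (surjf y))).
have fK : cancel f g by move=> x; apply: injf; rewrite gK.
have cg : continuous g.
  apply/continuousP => U oU.
  have -> : g @^-1` U = ~` (f @` (~` U)).
    apply/seteqP; split=> y /= => [Uy [x Ux fx]|h].
      by apply: Ux; rewrite -fx fK in Uy.
    by apply: contrapT => Uy; apply: h; exists (g y).
  apply: closed_openC; apply: compact_closed => //; apply: continuous_compact.
    exact: continuous_subspaceT.
  by apply: (subclosed_compact _ cS) => //; exact: open_closedC.
by exists (Homeo fK gK cf cg).
Qed.

Lemma expgzD_apply (T : topologicalType) (g : homeo T T) (i j : int) (x : T) :
  expgz g (i + j) x = expgz g i (expgz g j x).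
Proof. by rewrite expgzD. Qed.

Section FullShift.
Context {A : finType}.

Lemma coordinate_lc (j : int) : locally_constant (fun a : fullshift A => a j).
Proof.
move=> a; have := @proj_continuous _ (fun=> discrete_topology A) j a.
by move=> /(_ _ (@discrete_set1 (discrete_topology A) (a j))).
Qed.

Lemma fullshift_hausdorff : hausdorff_space (fullshift A).
Proof.
apply: (locally_constant_hausdorff coordinate_lc) => x y xy; exact/funext.
Qed.

Lemma fullshift_compact : compact [set: fullshift A].
Proof.
have := @tychonoff int (fun=> discrete_topology A) (fun=> setT).
rewrite (_ : [set f | _] = setT); last exact/seteqP.
by apply=> i; apply: finite_compact; exact: finite_finset.
Qed.

Lemma sigma_expgz (X : subshift A) (x : X) (j k : int) :
  \val (expgz (sigma X) j x) k = \val x (k + j).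
Proof.
have S n (y : X) i : \val (expgz (sigma X) (Posz n) y) i = \val y (i + n).
  elim: n i => [|n ih] i; first by rewrite addr0.
  rewrite (_ : Posz n.+1 = n%:Z + 1) ?expgzS; last lia.
  by apply: (etrans (ih (i + 1))); congr (\val y _); lia.
have [j0|j0] := leP 0 j; first by rewrite -[j]gez0_abs // S.
have {2}-> : x = expgz (sigma X) `|j|%N (expgz (sigma X) j x).
  by rewrite -expgzD_apply (_ : _ + j = 0) //; lia.
by rewrite S; congr (\val _ _); lia.
Qed.

Lemma subshift_coordinate_lc (X : subshift A) j : locally_constant (fun x : X => \val x j).
Proof.
apply: (locally_constant_comp (f := fun a : fullshift A => a j)).
  exact: coordinate_lc.
exact: initial_continuous.
Qed.

Lemma subshift_hausdorff (X : subshift A) : hausdorff_space X.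
Proof.
apply: (@locally_constant_hausdorff X int A (fun j x => \val x j)).
  exact: subshift_coordinate_lc.
by move=> x y xy; apply/val_inj/funext.
Qed.

End FullShift.

Section Itinerary.
Context {T : topologicalType} {A : finType} (tau : homeo T T) (e : T -> A).
Hypothesis compactT : compact [set: T].
Hypothesis e_lc : locally_constant e.

Definition itinerary (x : T) : fullshift A := fun j => e (expgz tau j x).

Lemma itinerary_continuous : continuous itinerary.
Proof.
apply: prod_topology_continuous => j x U /= /nbhs_singleton Ux.
have := locally_constant_comp e_lc (@homeo_continuous _ _ (expgz tau j)).
move=> /(_ x); apply: filterS => y /= yx.
by rewrite /itinerary /= yx.
Qed.

Lemma itinerary_closed : closed (range itinerary).
Proof.
apply: compact_closed; first exact: fullshift_hausdorff.
apply: continuous_compact => //.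
exact/continuous_subspaceT/itinerary_continuous.
Qed.

Lemma itinerary_shift x : Defs.shift (itinerary x) = itinerary (tau x).
Proof.
apply/funext => j; rewrite /Defs.shift /itinerary expgzS (expgz_comm j (commute_refl tau)).
by [].
Qed.

Lemma itinerary_range : @Defs.shift A @` range itinerary = range itinerary.
Proof.
apply/seteqP; split=> [_ [_ [x _ <-] <-]|_ [x _ <-]].
  by exists (tau x); rewrite ?itinerary_shift.
exists (itinerary (homeo_inv tau x)); first by exists (homeo_inv tau x).
by rewrite itinerary_shift homeo_invK.
Qed.

End Itinerary.

(** * Resolving graph-homomorphisms and rays *)

Section Resolving.
Context {B A : finType} {Gamma : graph B} {G : graph A} (h : graph_hom Gamma G).
Context (Z : set (fullshift B)).
Hypothesis closedZ : closed Z.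
Hypothesis Zpaths : Z `<=` paths Gamma.
Hypothesis Zshift : @Defs.shift B @` Z = Z.
Hypothesis injZ : set_inj Z (Defs.path_map h).

Lemma shift_invariant_translate z (k : int) : Z z -> Z (fun j => z (j + k)).
Proof.
have S y : Z y -> Z (fun j => y (j + 1)) by move=> Zy; rewrite -Zshift; exists y.
have U y : Z y -> Z (fun j => y (j - 1)).
  rewrite -{1}Zshift => -[y' Zy' <-].
  rewrite (_ : (fun j => _) = y') //; apply/funext => j.
  by rewrite /Defs.shift subrK.
move=> Zz; elim/int_rec: k => [|k ih|k ih].
- by rewrite (_ : (fun j => _) = z) //; apply/funext => j; rewrite addr0.
- move: (S _ ih); rewrite (_ : (fun j => _) = (fun j : int => z (j + k.+1%:Z))) //.
  by apply/funext => j; congr z; lia.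
- move: (U _ ih); rewrite (_ : (fun j => _) = (fun j : int => z (j - k.+1%:Z))) //.
  by apply/funext => j; congr z; lia.
Qed.

(** The inverse of the injective map [path_map h] on [Z] is a sliding block code: compactness gives
    the window at 0, and shift invariance moves it to [k]. *)
Lemma resolving_window : exists N : nat, forall z z' (k : int), Z z -> Z z' ->
  (forall j : int, `|j - k| <= N -> Defs.path_map h z j = Defs.path_map h z' j) -> z k = z' k.
Proof.
have cZ : compact Z.
  by apply: (subclosed_compact closedZ (@fullshift_compact B)).
have [|||N HN] := finite_window (J := setT) (f := fun j z => Defs.path_map h z j)
    (g := fun z : fullshift B => z 0) cZ.
- move=> j z; apply: filterS (@coordinate_lc B j z) => z' e.
  by rewrite /Defs.path_map e.
- exact: coordinate_lc.
- move=> z z' Zz Zz' hz; suff -> : z = z' by [].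
  by apply: injZ; rewrite ?inE //; apply/funext => j; exact: hz.
exists N => z z' k Zz Zz' hz.
have := HN (fun j => z (j + k)) (fun j => z' (j + k)).
rewrite add0r; apply; [exact: shift_invariant_translate|exact: shift_invariant_translate|].
by move=> j _ jN; apply: (hz (j + k)); rewrite addrK.
Qed.

(** The window alone recovers the arcs from [N] onwards. There the two paths share vertices, and
    left resolution recovers one further arc at a time, down to 0, so no part of the ray is lost. *)
Lemma left_resolving_ray z z' : weakly_left_resolving h -> Z z -> Z z' ->
  (forall j : int, 0 <= j -> Defs.path_map h z j = Defs.path_map h z' j) ->
  forall j : int, 0 <= j -> z j = z' j.
Proof.
move=> hL Zz Zz' hz; have [N HN] := resolving_window.
have far (j : int) : N%:Z <= j -> z j = z' j.
  by move=> jN; apply: HN => // i ij; apply: hz; lia.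
have down (k : nat) (j : int) : 0 <= j -> N%:Z <= j + k -> z j = z' j.
  elim: k j => [|k ih] j j0 jN; first by apply: far; lia.
  apply: hL; congr pair; last exact: hz.
  by rewrite (Zpaths Zz j) (Zpaths Zz' j) (ih (j + 1)) //; lia.
by move=> j j0; apply: (down N) => //; lia.
Qed.

Lemma right_resolving_ray z z' : weakly_right_resolving h -> Z z -> Z z' ->
  (forall j : int, j <= 0 -> Defs.path_map h z j = Defs.path_map h z' j) ->
  forall j : int, j <= 0 -> z j = z' j.
Proof.
move=> hR Zz Zz' hz; have [N HN] := resolving_window.
have far (j : int) : j <= - N%:Z -> z j = z' j.
  by move=> jN; apply: HN => // i ij; apply: hz; lia.
have up (k : nat) (j : int) : j <= 0 -> j <= - N%:Z + k -> z j = z' j.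
  elim: k j => [|k ih] j j0 jN; first by apply: far; lia.
  apply: hR; congr pair; last exact: hz.
  have := Zpaths Zz (j - 1); have := Zpaths Zz' (j - 1); rewrite subrK => <- <-.
  by rewrite (ih (j - 1)) //; lia.
by move=> j j0; apply: (up N) => //; lia.
Qed.

End Resolving.

Section EssentiallyWeakly.
Context {T : topologicalType} (tau psi : homeo T T).

Lemma conjugate_expgz (S : topologicalType) (t : homeo T S) (s : homeo S S) :
  t \o tau = s \o t -> forall j x, t (expgz tau j x) = expgz s j (t x).
Proof.
move=> /funeqP ts; have P n x : t (expgz tau (Posz n) x) = expgz s (Posz n) (t x).
  elim: n x => [|n ih] x //.
  rewrite (_ : Posz n.+1 = n%:Z + 1) ?expgzS; last lia.
  by rewrite [LHS](ts (expgz tau n x)) /= ih.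
case=> [n|n] x; first exact: P.
have /(congr1 (expgz s (Negz n))) := P n.+1 (expgz tau (Negz n) x).
rewrite -!expgzD_apply (_ : n.+1%:Z + Negz n = 0); last lia.
rewrite (_ : Negz n + n.+1%:Z = 0) //; lia.
Qed.

Lemma ess_weakly_sub P : ess_weakly LR tau psi -> P <> LR -> ess_weakly P tau psi.
Proof.
move=> [aut [A [X [f [theta [[ef [G [B [Gamma [p [q [Z [[w1 w2] h1 h2 h3 h4]]]]]]]] e1 e2]]]]]] PLR.
split=> //; exists A, X, f, theta; split=> //; split=> //.
by exists G, B, Gamma, p, q, Z; split=> //; case: P PLR.
Qed.

(** Lifting a ray to [Z] along [p] loses nothing, as [p] is left-resolving, and [path_map q] acts
    arc by arc; so the image ray starts at the same coordinate. *)
Lemma ess_weakly_left_ray : ess_weakly PL tau psi ->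
  exists (A : finType) (c : T -> A), [/\ locally_constant c,
    forall x y, (forall j, c (expgz tau j x) = c (expgz tau j y)) -> x = y &
    forall x y, (forall j, 0 <= j -> c (expgz tau j x) = c (expgz tau j y)) ->
      forall j, 0 <= j -> c (expgz tau j (psi x)) = c (expgz tau j (psi y))].
Proof.
move=> [_ [A [X [f [theta [[_ [G [B [Gamma [p [q [Z [w [h1 h2 h3] [h4 h5] h6 h7]]]]]]]] e1 e2]]]]]].
exists A, (fun x => \val (theta x) 0).
have cE j x : \val (theta (expgz tau j x)) 0 = \val (theta x) j.
  by rewrite (conjugate_expgz e1) sigma_expgz add0r.
split.
- apply: (locally_constant_comp (f := fun y : X => \val y 0)).
    exact: subshift_coordinate_lc.
  exact: homeo_continuous.
- move=> x y xy; apply: (can_inj (@homeo_funK _ _ theta)).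
  by apply/val_inj/funext => j; have := xy j; rewrite !cE.
move=> x y xy j j0; rewrite !cE.
have lift (t : X) : exists2 z, Z z & Defs.path_map p z = \val t.
  by have := set_valP t; rewrite -[X in X _ -> _]h5 => -[z Zz <-]; exists z.
have [[z Zz zx] [z' Zz' zy]] := (lift (theta x), lift (theta y)).
have e t : theta (psi t) = f (theta t) by move/funeqP: e2 => /(_ t).
rewrite !e (h7 _ z) // (h7 _ z') // /Defs.path_map.
rewrite (left_resolving_ray h1 h2 h3 h4 w Zz Zz') // => i i0.
by rewrite zx zy; have := xy i i0; rewrite !cE.
Qed.

(** The lift is read along [q], so the implication runs from [psi x] back to [x]. Injectivity of
    [path_map q] on [Z] comes from injectivity of [psi]. *)
Lemma ess_weakly_right_ray : ess_weakly QR tau psi ->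
  exists (A : finType) (c : T -> A), [/\ locally_constant c,
    forall x y, (forall j, c (expgz tau j x) = c (expgz tau j y)) -> x = y &
    forall x y, (forall j, j <= 0 -> c (expgz tau j (psi x)) = c (expgz tau j (psi y))) ->
      forall j, j <= 0 -> c (expgz tau j x) = c (expgz tau j y)].
Proof.
move=> [_ [A [X [f [theta [[_ [G [B [Gamma [p [q [Z [w [h1 h2 h3] [h4 h5] h6 h7]]]]]]]] e1 e2]]]]]].
exists A, (fun x => \val (theta x) 0).
have cE j x : \val (theta (expgz tau j x)) 0 = \val (theta x) j.
  by rewrite (conjugate_expgz e1) sigma_expgz add0r.
have theta_inj := can_inj (@homeo_funK _ _ theta).
split.
- apply: (locally_constant_comp (f := fun y : X => \val y 0)).
    exact: subshift_coordinate_lc.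
  exact: homeo_continuous.
- move=> x y xy; apply: theta_inj.
  by apply/val_inj/funext => j; have := xy j; rewrite !cE.
have e t : theta (psi t) = f (theta t) by move/funeqP: e2 => /(_ t).
have image z : Z z -> exists t, Defs.path_map p z = \val (theta t).
  move=> Zz; have Xz : Defs.path_map p z \in (X : set _) by rewrite inE -h5; exists z.
  by exists (homeo_inv theta (exist _ (Defs.path_map p z) Xz : X)); rewrite homeo_invK.
have inj_q : set_inj Z (Defs.path_map q).
  move=> z z' /set_mem Zz /set_mem Zz'.
  have [[t ht] [t' ht']] := (image z Zz, image z' Zz').
  rewrite -(h7 _ _ Zz ht) -(h7 _ _ Zz' ht') => /val_inj; rewrite -!e.
  move=> /theta_inj /(can_inj (@homeo_funK _ _ psi)) tt'.
  by apply: h4; rewrite ?inE // ht ht' tt'.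
move=> x y xy j j0; rewrite !cE.
have lift (t : X) : exists2 z, Z z & Defs.path_map p z = \val t.
  by have := set_valP t; rewrite -[X in X _ -> _]h5 => -[z Zz <-]; exists z.
have [[z Zz zx] [z' Zz' zy]] := (lift (theta x), lift (theta y)).
rewrite -zx -zy /Defs.path_map.
rewrite (right_resolving_ray h1 h2 h3 inj_q w Zz Zz') // => i i0.
by rewrite -(h7 _ _ Zz zx) -(h7 _ _ Zz' zy) -!e; have := xy i i0; rewrite !cE.
Qed.

End EssentiallyWeakly.

(** * A textile system from a corner condition *)

Section TextileOfCorners.
Context {T : topologicalType} {F : finType} (tau psi : homeo T T) (pi : T -> F).
Hypothesis compactT : compact [set: T].
Hypothesis infiniteT : infinite_set [set: T].
Hypothesis pi_lc : locally_constant pi.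
Hypothesis pi_gen :
  forall x y, (forall j, pi (expgz tau j x) = pi (expgz tau j y)) -> x = y.
Hypothesis tau_psi : commute psi tau.

Let edge (x : T) : F * F := (pi x, pi (tau x)).

Let edge_lc : locally_constant edge.
Proof.
move=> x; near=> y; rewrite /edge; congr pair; near: y; first exact: pi_lc.
exact: (locally_constant_comp pi_lc (@homeo_continuous _ _ tau)).
Unshelve. all: by end_near. Qed.

Let edge_gen x y :
  (forall j, edge (expgz tau j x) = edge (expgz tau j y)) -> x = y.
Proof. by move=> xy; apply: pi_gen => j; case: (xy j). Qed.

(* Arcs are the 2 x 2 blocks of values of [pi], read along [tau] horizontally and
   [psi] vertically; the two horizontal edges are the letters and the two vertical
   edges the end vertices. *)
Let square_mem (x : T) :
  (edge x, edge (psi x)) \in [pred b | `[<exists t, b = (edge t, edge (psi t))>]].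
Proof. by rewrite inE; exists x. Qed.

(** Only blocks realised by a point are arcs: the corner conditions say nothing about other
    blocks. *)
Let square_type : finType :=
  {b : (F * F) * (F * F) | b \in [pred b | `[<exists t, b = (edge t, edge (psi t))>]]}.

Let square (x : T) : square_type := exist _ (edge x, edge (psi x)) (square_mem x).

Let squareP (b : square_type) : exists x, b = square x.
Proof.
case: b => b hb; have := hb; rewrite inE => -[x bx].
by exists x; exact: val_inj.
Qed.

Let square_lc : locally_constant square.
Proof.
move=> x; near=> y; apply: val_inj; congr pair; near: y; first exact: edge_lc.
exact: (locally_constant_comp edge_lc (@homeo_continuous _ _ psi)).
Unshelve. all: by end_near. Qed.

Let alphabet_gt1 : (1 < #|{: F * F}|)%N.
Proof.
have [x [y xy]] : exists x y : T, x <> y.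
  apply: contrapT => h; apply: infiniteT.
  have [T0|/set0P[x _]] := eqVneq [set: T] set0; first by rewrite T0.
  suff -> : [set: T] = [set x] by exact: finite_set1.
  apply/seteqP; split=> // y _; apply: contrapT => yx; apply: h.
  by exists y, x.
have [j nj] : exists j, edge (expgz tau j x) <> edge (expgz tau j y).
  apply: contrapT => h; apply: xy; apply: edge_gen => j; apply: contrapT => nj.
  by apply: h; exists j.
apply/card_gt1P; exists (edge (expgz tau j x)), (edge (expgz tau j y)).
by split=> //; exact/eqP.
Qed.

Let edge_shift : subshift (F * F)%type :=
  Subshift alphabet_gt1 (itinerary_closed compactT edge_lc)
    (itinerary_range tau edge).

Let psi_itinerary x j : edge (psi (expgz tau j x)) = edge (expgz tau j (psi x)).
Proof.
congr edge.
by have := expgz_comm j tau_psi => /(congr1 (fun g : homeo T T => g x)).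
Qed.

(** Weak resolution involves only the vertices of [Gamma], so [G] can have all letters as loops at
    one vertex. *)
Let one_vertex : graph (F * F)%type := @Graph _ unit (fun=> tt) (fun=> tt).

Let squares : graph square_type :=
  @Graph square_type (F * F)%type (fun b => ((\val b).1.1, (\val b).2.1))
    (fun b => ((\val b).1.2, (\val b).2.2)).

Let bottom : graph_hom squares one_vertex :=
  @GraphHom _ _ squares one_vertex (fun b => (\val b).1) (fun=> tt) (fun=> erefl) (fun=> erefl).

Let top : graph_hom squares one_vertex :=
  @GraphHom _ _ squares one_vertex (fun b => (\val b).2) (fun=> tt) (fun=> erefl) (fun=> erefl).

Let left_corner : Prop := forall x y, pi x = pi y -> pi (tau x) = pi (tau y) ->
  pi (tau (psi x)) = pi (tau (psi y)) -> pi (psi x) = pi (psi y).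

Let right_corner : Prop := forall x y, pi x = pi y -> pi (psi x) = pi (psi y) ->
  pi (tau (psi x)) = pi (tau (psi y)) -> pi (tau x) = pi (tau y).

Let left_resolving : left_corner -> weakly_left_resolving bottom.
Proof.
move=> corner b b'; have [[x ->] [y ->]] := (squareP b, squareP b').
case=> /= h1 h2 h3 h4; apply: val_inj => /=.
by rewrite /edge h1 h2 h3 (corner x y).
Qed.

Let right_resolving : right_corner -> weakly_right_resolving top.
Proof.
move=> corner b b'; have [[x ->] [y ->]] := (squareP b, squareP b').
case=> /= h1 h2 h3 h4; apply: val_inj => /=.
by rewrite /edge h1 h2 h4 (corner x y).
Qed.

(** The bottom edge and the terminal vertex of a block leave only the corner [psi x] unknown; the
    top edge and the initial vertex leave only [tau x]. Each hypothesis is asked for exactly when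
    [P] includes the corresponding resolution. *)
Lemma ess_weakly_of_corners (P : resolving) :
  (P <> QR -> forall x y, pi x = pi y -> pi (tau x) = pi (tau y) ->
     pi (tau (psi x)) = pi (tau (psi y)) -> pi (psi x) = pi (psi y)) ->
  (P <> PL -> forall x y, pi x = pi y -> pi (psi x) = pi (psi y) ->
     pi (tau (psi x)) = pi (tau (psi y)) -> pi (tau x) = pi (tau y)) ->
  ess_weakly P tau psi.
Proof.
move=> hL hR; split; first exact: tau_psi.
have itin_mem x : itinerary tau edge x \in (edge_shift : set _).
  by apply/mem_set; exists x.
have itin_inj : injective (itinerary tau edge).
  by move=> x y xy; apply: edge_gen => j; exact: (congr1 (@^~ j) xy).
have [||||theta thetaE] := @homeo_of_bijection T edge_shift
    (fun x => exist _ (itinerary tau edge x) (itin_mem x)) compactT.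
- exact: subshift_hausdorff.
- by apply: continuous_comp_initial; exact: itinerary_continuous.
- by move=> x y /(congr1 \val)/itin_inj.
- move=> y; have [x _ xy] := set_valP y; exists x; exact: val_inj.
have theta_val x : \val (theta x) = itinerary tau edge x by rewrite thetaE.
have theta_tau : theta \o tau = sigma edge_shift \o theta.
  apply/funext => x; apply: val_inj.
  by rewrite /= !theta_val -itinerary_shift.
exists (F * F)%type, edge_shift, (theta \o psi \o homeo_inv theta), theta.
split=> //; last by apply/funext => x /=; rewrite homeo_funK.
split.
  split.
    move=> y; apply: continuous_comp; first exact: homeo_inv_continuous.
    by apply: continuous_comp; exact: homeo_continuous.
  apply/funext => y; rewrite -[y](homeo_invK theta); set x := homeo_inv theta y.
  change (theta (psi (homeo_inv theta (sigma edge_shift (theta x)))) =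
    sigma edge_shift (theta (psi (homeo_inv theta (theta x))))).
  have theta_tau' t : theta (tau t) = sigma edge_shift (theta t).
    exact: (congr1 (@^~ t) theta_tau).
  rewrite -theta_tau' !homeo_funK -theta_tau'; congr (theta _).
  exact: (congr1 (fun g : homeo T T => g x) tau_psi).
have bottomE x : Defs.path_map bottom (itinerary tau square x) = itinerary tau edge x.
  by [].
have topE x : Defs.path_map top (itinerary tau square x) = itinerary tau edge (psi x).
  by apply/funext => j; exact: psi_itinerary.
exists one_vertex, square_type, squares, bottom, top, (range (itinerary tau square)).
split.
- by case: P hL hR => /= hL hR; [apply: left_resolving; exact: hL|apply: right_resolving; exact: hR|
    split; [apply: left_resolving; exact: hL|apply: right_resolving; exact: hR]].
- split.
  + exact: (itinerary_closed compactT square_lc).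
  + move=> _ [x _ <-] j; rewrite /= /itinerary /= expgzS.
    congr pair; congr pi.
    by have /(congr1 (fun g : homeo T T => g (expgz tau j x))) := tau_psi.
  + exact: itinerary_range.
- split.
    move=> _ _ /set_mem[x _ <-] /set_mem[y _ <-].
    by rewrite !bottomE => /itin_inj ->.
  apply/seteqP; split=> [_ [_ [x _ <-] <-]|_ [x _ <-]]; first by exists x.
  by exists (itinerary tau square x) => //; exists x.
- by move=> _ [_ [x _ <-] <-]; rewrite topE; exists (psi x).
- move=> y _ [x _ <-]; rewrite bottomE => xy.
  have -> : y = theta x by apply: val_inj; rewrite theta_val.
  by rewrite /= homeo_funK theta_val topE.
Qed.

End TextileOfCorners.

(* Patterns on [0, N] determine the past, and distinct points stay distinguished by
   them under all large powers of [tau]; so there are at most as many points as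
   patterns. *)
Lemma one_sided_finite (T : topologicalType) (F : finType) (tau : homeo T T)
    (pi : T -> F) : compact [set: T] -> locally_constant pi ->
  (forall x y, (forall j, 0 <= j -> pi (expgz tau j x) = pi (expgz tau j y)) -> x = y) ->
  finite_set [set: T].
Proof.
move=> cT lpi one_sided.
have lc j : locally_constant (pi \o expgz tau j).
  by apply: locally_constant_comp => //; exact: homeo_continuous.
have [|N HN] := finite_window (J := [set j | 0 <= j]) cT lc (lc (-1)).
  by move=> x y _ _ /one_sided ->.
have {}HN x y : (forall j, 0 <= j <= N%:Z -> pi (expgz tau j x) = pi (expgz tau j y)) ->
    pi (expgz tau (-1) x) = pi (expgz tau (-1) y).
  by move=> h; apply: HN => // j /= j0 jN; apply: h; lia.
pose g x : {ffun 'I_N.+1 -> F} := [ffun i : 'I_N.+1 => pi (expgz tau (i : nat)%:Z x)].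
have gP x y : g x = g y -> forall j : int, 0 <= j <= N%:Z ->
    pi (expgz tau j x) = pi (expgz tau j y).
  move=> /ffunP h j /andP[j0 jN]; have jN' : (`|j| < N.+1)%N by lia.
  by have := h (Ordinal jN'); rewrite !ffunE (_ : (Ordinal jN')%:Z = j) //=; lia.
have step x y k : g (expgz tau (k + 1) x) = g (expgz tau (k + 1) y) ->
    g (expgz tau k x) = g (expgz tau k y).
  move=> /gP h; apply/ffunP => i; rewrite !ffunE -!expgzD_apply.
  case: i => -[|i] hi /=; last first.
    have := h i%:Z; rewrite -!expgzD_apply.
    rewrite (_ : i%:Z + (k + 1) = i.+1%:Z + k); last lia.
    by apply; lia.
  have := HN (expgz tau (k + 1) x) (expgz tau (k + 1) y) h.
  by rewrite -!expgzD_apply (_ : -1 + (k + 1) = 0%:Z + k) //; lia.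
have separate x y : x <> y -> exists k0 : nat, forall k : nat, (k0 <= k)%N ->
    g (expgz tau k%:Z x) <> g (expgz tau k%:Z y).
  move=> xy; have [j [j0 nj]] :
      exists j, 0 <= j /\ pi (expgz tau j x) <> pi (expgz tau j y).
    apply: contrapT => h; apply: xy; apply: one_sided => j j0.
    by apply: contrapT => nj; apply: h; exists j.
  exists `|j|%N; elim=> [|k ih] jk gk.
    apply: nj; rewrite (_ : j = 0); last lia.
    by have := gP _ _ gk 0; apply; lia.
  have [jk'|jk'] := leqP `|j|%N k.
    by apply: (ih jk'); apply: step; rewrite (_ : k%:Z + 1 = k.+1%:Z) //; lia.
  apply: nj; rewrite (_ : j = 0 + k.+1%:Z); last lia.
  by rewrite !expgzD_apply; apply: (gP _ _ gk); lia.
have separate_seq (s : seq (T * T)) : (forall z, z \in s -> z.1 <> z.2) ->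
    exists k0 : nat, forall k : nat, (k0 <= k)%N -> forall z, z \in s ->
      g (expgz tau k%:Z z.1) <> g (expgz tau k%:Z z.2).
  elim: s => [|z s ih] hs; first by exists 0%N.
  have [|k1 h1] := ih; first by move=> z' z's; apply: hs; rewrite in_cons z's orbT.
  have [|k2 h2] := separate z.1 z.2; first by apply: hs; rewrite mem_head.
  exists (k1 + k2)%N => k kk z'; rewrite in_cons => /orP[/eqP->|z's].
    by apply: h2; lia.
  by apply: h1 => //; lia.
apply: contrapT => /infinite_set_fset-/(_ #|{: {ffun 'I_N.+1 -> F}}|.+1)[S _ cS].
pose l : seq T := finmap.enum_fset S.
pose pairs := [seq z <- [seq (x, y) | x <- l, y <- l] | z.1 != z.2].
have [|k hk] := separate_seq pairs.
  by move=> z; rewrite mem_filter => /andP[/eqP].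
have inj : {in l &, injective (fun x => g (expgz tau k%:Z x))}.
  move=> x y xS yS gxy; apply: contrapT => /eqP xy.
  apply: (hk k (leqnn k) (x, y)) => //.
  by rewrite mem_filter /= xy; exact: allpairs_f.
have u : uniq [seq g (expgz tau k%:Z x) | x <- l].
  by rewrite map_inj_in_uniq ?finmap.fset_uniq.
have := uniq_leq_size u (fun z _ => mem_enum _ z).
by rewrite size_map -cardE leqNgt cS.
Qed.

(** * Segments and connected components of the plane *)

Section Plane.
Context {R : realType}.
Implicit Types (a b e n : R * R) (S : set (R * R)).

Lemma near_box (P : set (R * R)) e : (\forall m \near e, P m) ->
  exists2 eps : R, 0 < eps &
    forall m, `|m.1 - e.1| < eps -> `|m.2 - e.2| < eps -> P m.
Proof.
move=> /nbhs_ballP[eps /= eps0 h]; exists eps => // m m1 m2; apply: h.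
by split; rewrite -ball_normE /= distrC.
Qed.

Lemma segment_component S a b :
  (forall t, 0 <= t <= 1 -> S ((1 - t) * a.1 + t * b.1, (1 - t) * a.2 + t * b.2)) ->
  connected_component S a b.
Proof.
move=> h; pose g t : R * R := ((1 - t) * a.1 + t * b.1, (1 - t) * a.2 + t * b.2).
have cl (x y : R) : continuous (fun t : R => (1 - t) * x + t * y).
  move=> t; apply: cvgD; apply: cvgM; (try exact: cvg_cst); (try exact: cvg_id).
  by apply: cvgB; [exact: cvg_cst | exact: cvg_id].
have cg : continuous g by move=> t; exact: (cvg_pair (cl a.1 b.1 t) (cl a.2 b.2 t)).
exists (g @` `[0, 1]); last first.
  by exists 1; rewrite /g ?subrr ?mul0r ?add0r ?mul1r -?surjective_pairing //= in_itv /= lexx ler01.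
split.
- by exists 0; rewrite /g ?subr0 ?mul0r ?addr0 ?mul1r -?surjective_pairing //= in_itv /= lexx ler01.
- by move=> _ [t /= t01 <-]; apply: h; rewrite in_itv /= in t01.
apply: connected_continuous_connected; first exact: segment_connected.
exact: continuous_subspaceT.
Qed.

Lemma component_crosses S a b n : connected_component S a b ->
  n.1 * a.1 + n.2 * a.2 < 0 -> 0 < n.1 * b.1 + n.2 * b.2 ->
  exists2 z, S z & n.1 * z.1 + n.2 * z.2 = 0.
Proof.
move=> [C [Ca CS cC] Cb] na nb; pose f (z : R * R) := n.1 * z.1 + n.2 * z.2.
have cf : continuous f.
  move=> z; apply: cvgD; apply: cvgM; (try exact: cvg_cst); [exact: cvg_fst|exact: cvg_snd].
have cfC : connected (f @` C).
  by apply: connected_continuous_connected => //; exact: continuous_subspaceT.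
have /connected_intervalP itv := cfC.
have fa : (f @` C) (f a) by exists a.
have fb : (f @` C) (f b) by exists b.
have [|z Cz fz] := itv _ _ fa fb 0; first by rewrite !ltW.
by exists z => //; exact: CS.
Qed.

Lemma connected_component_mono S S' a b :
  S `<=` S' -> connected_component S a b -> connected_component S' a b.
Proof. by move=> SS' [C [Ca CS cC] Cb]; exists C => //; split=> // z /CS/SS'. Qed.

End Plane.

(** * Chains of arrows *)

Section Chains.
Context {R : realType} {T : topologicalType} (d : T -> T -> R) (K : set (homeo T T)).
Context (arr : homeo T T -> homeo T T -> Prop).
Implicit Types psi rho tau : homeo T T.

Lemma chain_one psi tau : expansive_elements d K tau -> arr psi tau ->
  chain d K arr psi tau.
Proof.
move=> Etau pt; exists 1%N, (fun i => if i is 0%N then psi else tau).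
by split=> // -[|[|i]].
Qed.

Lemma chain_cons psi rho tau : expansive_elements d K rho -> arr psi rho ->
  chain d K arr rho tau -> chain d K arr psi tau.
Proof.
move=> Erho pr [r [t [r0 t0 tr tE ta]]].
exists r.+1, (fun i => if i is j.+1 then t j else psi); split=> //.
  by case=> [|[|i]] //= ir; [rewrite t0|exact: tE].
by case=> [|i] //= ir; [rewrite t0|exact: ta].
Qed.

Lemma chain_ind (Q : homeo T T -> Prop) tau :
  (forall psi, expansive_elements d K tau -> arr psi tau -> Q psi) ->
  (forall psi rho, expansive_elements d K rho -> arr psi rho -> Q rho -> Q psi) ->
  forall psi, chain d K arr psi tau -> Q psi.
Proof.
move=> Q1 QS psi [r [t [r0 <- tr tE ta]]].
suff h k : (k < r)%N -> Q (t (r - k.+1)%N).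
  by have := h r.-1; rewrite prednK // subnn; apply.
elim: k => [|k ih] kr.
  apply: Q1; rewrite -tr; first by apply: tE; rewrite r0 /=.
  by have := ta (r - 1)%N; rewrite -subSn // subSS subn0; apply; lia.
have e : ((r - k.+2).+1 = r - k.+1)%N by lia.
apply: (QS _ (t (r - k.+1)%N)); [apply: tE; lia| |apply: ih; lia].
by rewrite -e; apply: ta; lia.
Qed.

Lemma chain_rcons psi rho tau : expansive_elements d K tau ->
  chain d K arr psi rho -> arr rho tau -> chain d K arr psi tau.
Proof.
move=> Etau pr rt; move: psi pr; apply: chain_ind => [psi Erho pr|psi rho' Erho' pr].
  exact: chain_cons Erho pr (chain_one Etau rt).
exact: chain_cons.
Qed.

End Chains.

(** * Coding by half-planes *)

Definition ip (u v : int * int) : int := u.1 * v.1 + u.2 * v.2.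

Lemma sqrt_le_self (a b : int) (r : nat) : a * a + b * b <= (r * r)%N ->
  `|a| <= r /\ `|b| <= r.
Proof. by move=> h; split; nia. Qed.

Lemma disc_of_box (a b : int) (r : nat) : `|a| <= r%:Z -> `|b| <= r%:Z ->
  a * a + b * b <= ((r + r) * (r + r))%N.
Proof.
move=> ha hb; have : a * a <= r%:Z * r%:Z by nia.
have : b * b <= r%:Z * r%:Z by nia.
by lia.
Qed.

Section Dot.
Context {R : realType}.
Implicit Types (n : R * R) (u v w : int * int).

Definition dot n u : R := n.1 * u.1%:~R + n.2 * u.2%:~R.

Lemma dotD n u v : dot n (u + v) = dot n u + dot n v.
Proof. by rewrite /dot /= !intrD; ring. Qed.

Lemma dotN n u : dot n (- u) = - dot n u.
Proof. by rewrite /dot /= !mulrNz; ring. Qed.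

Lemma dotMz n u j : dot n (u *~ j) = j%:~R * dot n u.
Proof. by rewrite /dot (raddfMz fst) (raddfMz snd) !mulrzz !intrM; ring. Qed.

Lemma dot_continuous u : continuous (dot ^~ u).
Proof.
by move=> n; apply: cvgD; apply: cvgM; (try exact: cvg_cst); [exact: cvg_fst|exact: cvg_snd].
Qed.

Lemma dotNl n u : dot (- n) u = - dot n u.
Proof. by rewrite /dot /=; ring. Qed.

Lemma dot_unbounded n (b : R) : n <> 0 -> exists u, dot n u <= b.
Proof.
move=> n0.
have [u u0] : exists u, dot n u < 0.
  apply: contrapT => h; apply: n0.
  have h' u : dot n u = 0.
    apply/eqP; rewrite eq_le; apply/andP; split; rewrite leNgt; apply/negP => hu;
      apply: h; [exists (- u); rewrite dotN oppr_lt0|exists u] => //.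
  move: (h' (1, 0)) (h' (0, 1)); rewrite /dot /= !mulr0 addr0 add0r !mulr1.
  by case: n {h h'} => a b' /= -> ->.
have := archi_boundP (normr_ge0 (b / dot n u)).
set m := Num.bound _ => hm; exists (u *~ m%:Z); rewrite dotMz.
have : b / dot n u <= m%:R by apply: le_trans (ltW hm); exact: ler_norm.
by rewrite ler_ndivrMr.
Qed.

Lemma dot_disc n (r : nat) u : ip u u <= (r * r)%N ->
  dot n u <= `|n.1| * r%:R + `|n.2| * r%:R.
Proof.
move=> ur; have [u1 u2] := sqrt_le_self ur.
apply: (le_trans (ler_norm _)); apply: (le_trans (ler_normD _ _)).
rewrite !normrM; apply: lerD; apply: ler_wpM2l => //.
  by rewrite -intr_norm -[_%:R]/(_%:Z%:~R) ler_int.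
by rewrite -intr_norm -[_%:R]/(_%:Z%:~R) ler_int.
Qed.

End Dot.

(** * Coding normals: openness and uniformity *)

Section Coding.
Context {R : realType} {T : topologicalType} {A : finType} (c : T -> A) (s p : homeo T T).
Hypothesis compactT : compact [set: T].
Hypothesis c_lc : locally_constant c.
Hypothesis c_gen : forall x y, (forall j, c (expgz s j x) = c (expgz s j y)) -> x = y.
Hypothesis sp : commute p s.
Implicit Types (x y : T) (n : R * R) (u v w q : int * int).

Definition agree x y u : Prop := c (act s p u x) = c (act s p u y).

Lemma act_apply u v x : act s p u (act s p v x) = act s p (u + v) x.
Proof. by rewrite actD. Qed.

Lemma act_inj u : injective (act s p u).
Proof. exact: can_inj (@homeo_funK _ _ _). Qed.

Lemma agree_act u v x y :
  agree (act s p u x) (act s p u y) v <-> agree x y (v + u).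
Proof. by rewrite /agree !act_apply. Qed.

Lemma agree_eq x y : (forall u, agree x y u) -> x = y.
Proof. by move=> h; apply: c_gen => j; rewrite -!(act_vertical s p) h. Qed.

Lemma agree_near u (z : T * T) :
  \forall z' \near z, agree z'.1 z'.2 u <-> agree z.1 z.2 u.
Proof.
have lc : locally_constant (c \o act s p u).
  by apply: locally_constant_comp; [exact: c_lc | exact: homeo_continuous].
apply: filterS (locally_constant_near2 z lc) => z' /= [e1 e2].
by rewrite /agree e1 e2.
Qed.

Lemma compactTT : compact [set: T * T].
Proof. by rewrite -setXTT; exact: compact_setX. Qed.

Definition codes n : Prop :=
  forall x y, (forall u, dot n u <= 0 -> agree x y u) -> x = y.

Lemma codes_shift n (b : R) x y : n <> 0 -> codes n ->
  (forall u, dot n u <= b -> agree x y u) -> x = y.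
Proof.
move=> n0 cn h; have [u0 u0b] := dot_unbounded b n0.
apply: (@act_inj u0); apply: cn => u u_le; apply/agree_act/h.
by rewrite dotD; lra.
Qed.

(** Compactness shows, for all [m] near [n] at once, that agreement where [dot m u < -1] forces
    agreement at 0; the strict inequality makes this an open condition on [m]. The gap of 1 then
    lets the known half-plane advance one level at a time. *)
Lemma codes_near n : n <> 0 -> codes n -> \forall m \near n, codes m.
Proof.
move=> n0 cn.
have := (iffLR (compact_near_coveringP _) compactTT) _ (nbhs n)
  (fun m z => (forall u, dot m u < -1 -> agree z.1 z.2 u) -> agree z.1 z.2 0) _ _.
case/(_ _ _)/Wrap => [z _|]; last first.
  apply: filterS => m hm x y xy; apply: agree_eq.
  suff h (k : nat) u : dot m u <= k%:R -> agree x y u.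
    move=> u; apply: (h (Num.bound `|dot m u|)).
    apply/ltW/(le_lt_trans (ler_norm _)); exact: archi_boundP (normr_ge0 _).
  elim: k u => [u|k ih u hu]; first exact: xy.
  rewrite -(add0r u); apply/agree_act; apply: (hm (_, _)) => //= v hv.
  by apply/agree_act/ih; rewrite dotD; rewrite -natr1 in hu; lra.
have [z0|nz0] := pselect (agree z.1 z.2 0).
  near=> z' m => _; suff [_] : agree z'.1 z'.2 0 <-> agree z.1 z.2 0 by apply.
  by near: z'; exact: agree_near.
have [u [hu nu]] : exists u, dot n u < -1 /\ ~ agree z.1 z.2 u.
  apply: contrapT => hz; apply: nz0; suff -> : z.1 = z.2 by [].
  apply: (@codes_shift n (-2)) => // u hu; apply: contrapT => nu; apply: hz.
  by exists u; split=> //; lra.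
have U : \forall m \near n, dot m u < -1.
  exact: (@cvgr_lt _ _ _ _ (dot ^~ u) _ (@dot_continuous _ u n)).
exists ([set z' | agree z'.1 z'.2 u <-> agree z.1 z.2 u], [set m | dot m u < -1]).
  by split => //=; exact: agree_near.
by move=> [z' m] /= [[h _] hm] /(_ u hm)/h.
Unshelve. all: by end_near. Qed.

(** [N] is both the slack around the cone of normals and the size of the window. A unit normal
    outside the closed cone is excluded by a small slack; one inside codes, so that a disagreement
    at 0 shows up in a finite window. *)
Lemma cone_uniform v w (b : R) :
  (forall n, n <> 0 -> dot n w <= 0 -> 0 <= dot n v -> codes n) ->
  exists N : nat, forall n, n.1 * n.1 + n.2 * n.2 = 1 ->
    dot n w <= N.+1%:R^-1 -> - N.+1%:R^-1 <= dot n v ->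
    forall x y, (forall u, ip u u <= N -> dot n u < - b -> agree x y u) ->
      agree x y 0.
Proof.
(* The compact square replaces the unit circle: unit length is a premise of [P], which is false in a
   neighbourhood of any point off the circle. *)
move=> cone; pose K : set (R * R) := `[-1, 1] `*` `[-1, 1].
have cK : compact (K `*` [set: T * T]).
  apply: compact_setX; last exact: compactTT.
  have cI : compact (`[-1, 1] : set R) by exact: segment_compact.
  exact: (compact_setX cI cI).
pose P (N : nat) (nz : (R * R) * (T * T)) := nz.1.1 * nz.1.1 + nz.1.2 * nz.1.2 = 1 ->
  dot nz.1 w <= N.+1%:R^-1 -> - N.+1%:R^-1 <= dot nz.1 v ->
  (forall u, ip u u <= N -> dot nz.1 u < - b -> agree nz.2.1 nz.2.2 u) ->
  agree nz.2.1 nz.2.2 0.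
have inv_le (i j : nat) : (i <= j)%N -> j.+1%:R^-1 <= i.+1%:R^-1 :> R.
  by move=> ij; rewrite lef_pV2 ?posrE ?ltr0n // ler_nat.
have cdot u (nz : (R * R) * (T * T)) : (dot nz'.1 u) @[nz' --> nz] --> dot nz.1 u.
  apply: (@cvg_comp _ _ _ fst (dot ^~ u)); first exact: cvg_fst.
  exact: dot_continuous.
have csq (nz : (R * R) * (T * T)) :
    (nz'.1.1 * nz'.1.1 + nz'.1.2 * nz'.1.2) @[nz' --> nz] -->
    nz.1.1 * nz.1.1 + nz.1.2 * nz.1.2.
  have c1 : nz'.1.1 @[nz' --> nz] --> nz.1.1.
    by apply: (@cvg_comp _ _ _ fst fst); [exact: cvg_fst|exact: cvg_fst].
  have c2 : nz'.1.2 @[nz' --> nz] --> nz.1.2.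
    by apply: (@cvg_comp _ _ _ fst snd); [exact: cvg_fst|exact: cvg_snd].
  by apply: cvgD; apply: cvgM.
have cagree u (nz : (R * R) * (T * T)) : \forall nz' \near nz,
    agree nz'.2.1 nz'.2.2 u <-> agree nz.2.1 nz.2.2 u.
  exact: (@cvg_snd _ _ _ _ _ _ (agree_near u nz.2)).
have [||N HN] := compact_uniform (P := P) cK; last first.
- exists N => n n1 nw nv x y h; apply: (HN (n, (x, y))) => //.
  by split=> //; split; rewrite /= in_itv /=; nra.
- move=> [n z] _; rewrite /P /=.
  have [n1|] := pselect (n.1 * n.1 + n.2 * n.2 = 1); last first.
    move/eqP; rewrite neq_lt => /orP[] hn; exists 0%N.
      near=> nz => /= n1; have : nz.1.1 * nz.1.1 + nz.1.2 * nz.1.2 < 1.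
        by near: nz; exact: (cvgr_lt _ (csq (n, z)) _ hn).
      by rewrite n1 ltxx.
    near=> nz => /= n1; have : 1 < nz.1.1 * nz.1.1 + nz.1.2 * nz.1.2.
      by near: nz; exact: (cvgr_gt _ (csq (n, z)) _ hn).
    by rewrite n1 ltxx.
  have [nw|nw] := leP (dot n w) 0; last first.
    have [k hk] : exists k : nat, k.+1%:R^-1 < dot n w.
      by have [k] := ltr_add_invr nw; rewrite add0r; exists k.
    exists k; near=> nz => _; have : k.+1%:R^-1 < dot nz.1 w.
      by near: nz; exact: (cvgr_gt _ (cdot w (n, z)) _ hk).
    by rewrite ltNge => /negP.
  have [nv|nv] := leP 0 (dot n v); last first.
    have [k hk] : exists k : nat, dot n v < - k.+1%:R^-1.
      have [|k] := @ltr_add_invr R 0 (- dot n v); first by rewrite oppr_gt0.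
      by rewrite add0r => hk; exists k; rewrite ltrNr.
    exists k; near=> nz => _ _; have : dot nz.1 v < - k.+1%:R^-1.
      by near: nz; exact: (cvgr_lt _ (cdot v (n, z)) _ hk).
    by rewrite ltNge => /negP.
  have n0 : n <> 0.
    move=> n0; move: n1; rewrite n0 /= mulr0 addr0; apply/eqP.
    by rewrite eq_sym oner_eq0.
  have [z0|nz0] := pselect (agree z.1 z.2 0).
    exists 0%N; near=> nz => _ _ _ _.
    suff [_] : agree nz.2.1 nz.2.2 0 <-> agree z.1 z.2 0 by apply.
    by near: nz; exact: (cagree 0 (n, z)).
  have [u [hu nu]] : exists u, dot n u < - b /\ ~ agree z.1 z.2 u.
    apply: contrapT => hz; apply: nz0; suff -> : z.1 = z.2 by [].
    apply: (@codes_shift n (- b - 1)) => //; first exact: cone.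
    move=> u hu; apply: contrapT => nu; apply: hz.
    by exists u; split=> //; lra.
  have U := cvgr_lt _ (cdot u (n, z)) _ hu.
  have V := cagree u (n, z).
  exists `|ip u u|%N; near=> nz => _ _ _ /(_ u) h; exfalso; apply: nu.
  suff [h' _] : agree nz.2.1 nz.2.2 u <-> agree z.1 z.2 u.
    apply/h'/h; first by lia.
    by near: nz; exact: U.
  by near: nz; exact: V.
- move=> i j nz ij Pi n1 nw nv h; apply: Pi => //.
  + by apply: le_trans (inv_le _ _ ij).
  + by apply: le_trans nv; rewrite lerN2 inv_le.
  + by move=> u ui; apply: h; lia.
Unshelve. all: by end_near. Qed.

(** Seen from [q], at distance l from 0, the disc is nearly a half-plane with outer normal q / l. A
    window point [u] with [dot n u < - k.+1] has |u + q|^2 <= N - 2 (k + 1) l + l^2 <= r^2, since l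
    - r <= k gives l^2 - r^2 <= 2 k l, and N <= r < l. *)
Lemma disc_extend v w (k : nat) :
  (forall n, n <> 0 -> dot n w <= 0 -> 0 <= dot n v -> codes n) ->
  exists r0 : nat, forall (r : nat) q, (r0 <= r)%N -> (r * r)%N%:Z < ip q q ->
    ip q q <= ((r + k) * (r + k))%N -> ip w q <= k -> 0 <= ip v q ->
    forall x y, (forall u, ip u u <= (r * r)%N -> agree x y u) -> agree x y q.
Proof.
move=> cone; have [N HN] := cone_uniform k.+1%:R cone.
(* The term [k.+1 * N.+1] brings (w.q) / l below the slack 1 / (N + 1). *)
exists (k.+1 * N.+1 + k * k + N)%N => r q r_ge q_gt q_le wq vq x y h.
pose l : R := Num.sqrt (ip q q)%:~R.
have l2 : l * l = q.1%:~R * q.1%:~R + q.2%:~R * q.2%:~R.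
  rewrite -expr2 sqr_sqrtr ?ler0z; last lia.
  by rewrite /ip intrD !intrM.
have l0 : 0 <= l by exact: sqrtr_ge0.
have q_gt' : (r%:R : R) * r%:R < q.1%:~R * q.1%:~R + q.2%:~R * q.2%:~R.
  by rewrite -natrM -!intrM -intrD -[_%:R]/(_%:Z%:~R) ltr_int.
have q_le' : q.1%:~R * q.1%:~R + q.2%:~R * q.2%:~R <= (r%:R + k%:R) * (r%:R + k%:R) :> R.
  by rewrite -natrD -natrM -!intrM -intrD -[_%:R]/(_%:Z%:~R) ler_int.
have r0 : 0 <= r%:R :> R by exact: ler0n.
have k0 : 0 <= k%:R :> R by exact: ler0n.
have r_ge' : k.+1%:R * N.+1%:R + k%:R * k%:R + N%:R <= r%:R :> R.
  by rewrite -!natrM -!natrD ler_nat.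
have lr : r%:R < l by nra.
have lpos : 0 < l by lra.
have wq' : w.1%:~R * q.1%:~R + w.2%:~R * q.2%:~R <= k%:R :> R.
  by rewrite -!intrM -intrD -[_%:R]/(_%:Z%:~R) ler_int.
have vq' : 0 <= v.1%:~R * q.1%:~R + v.2%:~R * q.2%:~R :> R.
  by rewrite -!intrM -intrD ler0z.
have dotq u : dot (q.1%:~R / l, q.2%:~R / l) u =
    (u.1%:~R * q.1%:~R + u.2%:~R * q.2%:~R) / l.
  by rewrite /dot /=; ring.
rewrite -(add0r q); apply/agree_act; apply: (HN (q.1%:~R / l, q.2%:~R / l)).
- rewrite /= !mulf_div -mulrDl -l2 divff // mulf_neq0 //; exact: lt0r_neq0.
- rewrite dotq ler_pdivrMr // [_^-1 * l]mulrC ler_pdivlMr ?ltr0n //.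
  apply: le_trans (ltW lr).
  have N0 : 0 <= N%:R :> R by exact: ler0n.
  move: r_ge'; rewrite -!natr1; nra.
- rewrite dotq; apply: (@le_trans _ _ 0); last by rewrite divr_ge0.
  by rewrite oppr_le0 invr_ge0 ler0n.
move=> u uN; rewrite dotq ltr_pdivrMr // => du.
apply/agree_act/h.
have uN' : u.1%:~R * u.1%:~R + u.2%:~R * u.2%:~R <= N%:R :> R.
  by rewrite -!intrM -intrD -[_%:R]/(_%:Z%:~R) ler_int.
rewrite -(ler_int R) /ip /= !intrD !intrM !intrD PoszM intrM.
rewrite -[r%:Z%:~R]/(r%:R : R).
move: du r_ge'; rewrite -!natr1; nra.
Qed.

Definition agree_disc (r : nat) x y : Prop :=
  forall u, ip u u <= (r * r)%N -> agree x y u.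

(* With [q = u + v] outside the three known discs, [|q - v| <= r < |q|] gives
   [0 < v.q] and [|q - v| <= r < |q - v - w|] bounds [w.q], so that [q / |q|] is
   nearly in the cone of coding normals. *)
Lemma disc_corner v w :
  (forall n, n <> 0 -> dot n w <= 0 -> 0 <= dot n v -> codes n) ->
  exists r0 : nat, forall (r : nat) x y, (r0 <= r)%N ->
    agree_disc r x y -> agree_disc r (act s p w x) (act s p w y) ->
    agree_disc r (act s p (v + w) x) (act s p (v + w) y) ->
    agree_disc r (act s p v x) (act s p v y).
Proof.
pose l (u : int * int) := (`|u.1|%N + `|u.2|%N)%N.
(* The term [l v] bounds |v|, hence |q| by r + k; the other two bound w.q. *)
pose k : int := (l v)%:Z + ip w w + `|ip w v|.
move=> /(disc_extend `|k|%N) [r0 Hr0]; exists r0 => r x y r_ge h0 hw hvw u hu.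
apply/agree_act; set q := u + v.
have [q_le|q_gt] := lerP (ip q q) (r * r)%N; first exact: h0.
have [|q_gt'] := lerP (ip (q - w) (q - w)) (r * r)%N.
  by move=> /hw/agree_act; rewrite subrK.
have [|q_gt''] := lerP (ip (q - (v + w)) (q - (v + w))) (r * r)%N.
  by move=> /hvw/agree_act; rewrite subrK.
have [u1 u2] := sqrt_le_self hu.
have uv : `|ip u v| <= r%:Z * (l v)%:Z.
  apply: (le_trans (ler_normD _ _)); rewrite !normrM /l /= PoszD !abszE mulrDr.
  by apply: lerD; exact: ler_wpM2r.
have vv : ip v v <= (l v * l v)%N.
  rewrite /ip /l; move: v.1 v.2 => a b.
  have -> : a * a = (`|a| * `|a|)%N by lia.
  have -> : b * b = (`|b| * `|b|)%N by lia.
  by rewrite -PoszD lez_nat; nia.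
have ww : 0 <= ip w w by rewrite /ip; nia.
have k0 : (l v)%:Z <= k by rewrite /k; lia.
have qq : ip q q = ip u u + 2 * ip u v + ip v v by rewrite /q /ip /=; ring.
have qw : ip (q - w) (q - w) = ip q q - 2 * ip w q + ip w w by rewrite /ip /=; ring.
have qv : ip u u = ip q q - 2 * ip v q + ip v v by rewrite /q /ip /=; ring.
have qvw : ip (q - (v + w)) (q - (v + w)) =
  ip u u + 2 * ip w v - 2 * ip w q + ip w w by rewrite /q /ip /=; ring.
have v0 : 0 <= ip v v by rewrite /ip; nia.
apply: (Hr0 r q) => //.
- have hl : 0 <= (l v)%:Z by [].
  by clearbody k l; move: uv vv k0; rewrite qq; nia.
- by rewrite /k; lia.
- by lia.
Qed.

Lemma codes_scale n (t : R) : 0 < t -> codes n -> codes (t * n.1, t * n.2).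
Proof.
move=> t0 cn x y h; apply: cn => u hu; apply: h.
have -> : dot (t * n.1, t * n.2) u = t * dot n u by rewrite /dot /=; ring.
by rewrite pmulr_rle0.
Qed.

(** The half-plane of the normal [rot e] is on the clockwise side of [e]; for e = (1, r) it is j <=
    r i. *)
Definition rot (e : R * R) : R * R := (- e.2, e.1).

Lemma orthogonal_rot n e : e <> 0 -> n.1 * e.1 + n.2 * e.2 = 0 ->
  exists t, n = (t * (rot e).1, t * (rot e).2).
Proof.
case: n e => [n1 n2] [a b] /= e0 ort.
have ne : a * a + b * b != 0.
  apply/eqP => h; apply: e0; have [a0 b0] : a = 0 /\ b = 0 by split; nra.
  by rewrite a0 b0.
exists ((n2 * a - n1 * b) / (a * a + b * b)); congr pair; apply: (mulIf ne).
  rewrite /= mulrAC mulfVK //.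
  have -> : n1 * (a * a + b * b) = a * (n1 * a + n2 * b) + b * (n1 * b - n2 * a) by ring.
  by rewrite ort; ring.
rewrite /= mulrAC mulfVK //.
have -> : n2 * (a * a + b * b) = b * (n1 * a + n2 * b) - a * (n1 * b - n2 * a) by ring.
by rewrite ort; ring.
Qed.

Lemma codes_orthogonal n e : n <> 0 -> e <> 0 -> n.1 * e.1 + n.2 * e.2 = 0 ->
  codes (rot e) -> codes (- rot e) -> codes n.
Proof.
move=> n0 e0 ort c1 c2; have [t nE] := orthogonal_rot e0 ort; rewrite nE.
have [t0|t0|t0] := ltgtP t 0.
- rewrite (_ : (_, _) = (- t * (- rot e).1, - t * (- rot e).2)).
    by apply: codes_scale; rewrite ?oppr_gt0.
  by congr pair; rewrite /= mulrNN.
- exact: codes_scale.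
- by case: n0; rewrite nE t0 !mul0r.
Qed.

Definition lat w : R * R := (w.1%:~R, w.2%:~R).

Lemma lat_neq0 w : w <> 0 -> lat w <> 0.
Proof.
by move=> w0 [/eqP + /eqP]; rewrite !intr_eq0 => /eqP a /eqP b; apply: w0;
  case: w a b => [a b] /= -> ->.
Qed.

(** With [v = w] the cone shrinks to the normals orthogonal to [w], all of which code. So agreement
    on a wide enough strip around the line of [w] extends to a strip one unit of [ip m] wider on
    both sides, while discs centred at the multiples of [w] cover the initial strip. *)
Lemma codes_line w : w <> 0 -> codes (rot (lat w)) -> codes (- rot (lat w)) ->
  exists r, forall x y,
    (forall j, agree_disc r (act s p (w *~ j) x) (act s p (w *~ j) y)) -> x = y.
Proof.
move=> w0 c1 c2.
have [|N HN] := @cone_uniform w w 0.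
  move=> n n0 h1 h2; apply: (codes_orthogonal n0 (lat_neq0 w0)) => //.
  by apply/eqP; rewrite eq_le; apply/andP.
pose m : int * int := (- w.2, w.1).
have ww : 0 < ip w w.
  case: w w0 {c1 c2 HN m} => a b w0; rewrite /ip /=.
  have : a != 0 \/ b != 0.
    have [a0|] := eqVneq a 0; last by left.
    by right; apply/eqP => b0; apply: w0; rewrite a0 b0.
  by case; nia.
have ext (e : int) x y : e * e = 1 ->
    (forall u, ip u u <= N -> e * ip m u < 0 -> agree x y u) -> agree x y 0.
  move=> ee h; pose l : R := Num.sqrt (ip w w)%:~R.
  have l2 : l * l = w.1%:~R * w.1%:~R + w.2%:~R * w.2%:~R.
    rewrite -expr2 sqr_sqrtr ?ler0z; last lia.
    by rewrite /ip intrD !intrM.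
  have lpos : 0 < l by rewrite sqrtr_gt0 ltr0z.
  have dotE u : dot (e%:~R * m.1%:~R / l, e%:~R * m.2%:~R / l) u = (e * ip m u)%:~R / l.
    by rewrite /dot /ip /= !intrM intrD !intrM; ring.
  apply: (HN (e%:~R * m.1%:~R / l, e%:~R * m.2%:~R / l)) => /=.
  - rewrite !mulf_div -mulrDl.
    have -> : e%:~R * m.1%:~R * (e%:~R * m.1%:~R) + e%:~R * m.2%:~R * (e%:~R * m.2%:~R)
        = (e * e)%:~R * (l * l) :> R by rewrite l2 /m /= !intrM mulrNz; ring.
    by rewrite ee mul1r divff // mulf_neq0 //; exact: lt0r_neq0.
  - rewrite dotE (_ : ip m w = 0) ?mulr0 ?mul0r ?invr_ge0 ?ler0n //.
    by rewrite /ip /m /=; ring.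
  - rewrite dotE (_ : ip m w = 0) ?mulr0 ?mul0r ?oppr_le0 ?invr_ge0 ?ler0n //.
    by rewrite /ip /m /=; ring.
  - move=> u uN; rewrite dotE oppr0 pmulr_llt0 ?invr_gt0 // ltrz0; exact: h.
(* [r0] bounds the reach of the window in the direction [m]: seen from a point just outside the
   strip, the inner half of the window does not overshoot the other side. *)
pose r0 : nat := (N * (`|m.1| + `|m.2|))%N.
have small u : ip u u <= N -> `|ip m u| <= r0%:Z.
  move=> uN; have [u1 u2] : `|u.1| <= N%:Z /\ `|u.2| <= N%:Z.
    by move: uN; rewrite /ip; split; nia.
  apply: (le_trans (ler_normD _ _)); rewrite !normrM /r0 PoszM PoszD !abszE mulrDr.
  by apply: lerD; rewrite mulrC; exact: ler_wpM2r.
exists (r0 + `|ip w w|)%N => x y h; apply: agree_eq => u.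
have strip (k : nat) q : `|ip m q| <= (r0 + k)%N%:Z -> agree x y q.
  elim: k q => [|k ih] q hq.
    pose j := (ip w q %/ ip w w)%Z; pose q' := q - w *~ j.
    have -> : q = q' + w *~ j by rewrite subrK.
    have wj : w *~ j = (w.1 * j, w.2 * j).
      by rewrite [LHS]surjective_pairing (raddfMz fst) (raddfMz snd) !mulrzz.
    apply/agree_act/h.
    have wq' : 0 <= ip w q' < ip w w.
      have -> : ip w q' = (ip w q %% ip w w)%Z.
        rewrite /q' wj {1}/ip /= [in RHS](_ : (ip w q %% ip w w)%Z = ip w q - j * ip w w).
          by rewrite /ip; ring.
        by rewrite {2}(divz_eq (ip w q) (ip w w)) -/j addrC addKr.
      by rewrite modz_ge0 ?ltz_pmod //; lia.
    have mq' : ip m q' = ip m q by rewrite /q' wj /ip /m /=; ring.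
    (* Pythagoras, as [m] is [w] turned by a right angle: it bounds the residue [q'] of [q] modulo
       [w]. *)
    have id : ip m q' * ip m q' + ip w q' * ip w q' = ip w w * ip q' q'.
      by rewrite /ip /m /=; ring.
    move: hq wq' id ww; rewrite -mq' addn0.
    have : 0 <= ip q' q' by rewrite /ip; nia.
    move: (ip m q') (ip w q') (ip w w) (ip q' q') => M W Q q2 q20 hM hW id Q0.
    have : q2 <= Q * q2 by nia.
    by rewrite -id => h'; apply: (le_trans h'); nia.
  have [hq'|hq'] := lerP `|ip m q| (r0 + k)%N%:Z; first exact: ih.
  have [e ee eq] : exists2 e : int, e * e = 1 & `|ip m q| = e * ip m q.
    by have [] := lerP 0 (ip m q); [exists 1|exists (-1)]; lia.
  rewrite -(add0r q); apply/agree_act; apply: (ext e) => // t tN mt.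
  apply/agree_act/ih; have := small t tN.
  have -> : ip m (t + q) = ip m t + ip m q by rewrite /ip /=; ring.
  have [e1|e1] : e = 1 \/ e = -1 by nia.
    by move: mt hq hq' eq; rewrite e1; lia.
  by move: mt hq hq' eq; rewrite e1; lia.
by apply: (strip `|ip m u|%N); lia.
Qed.

(** By Cramer's rule D u = a v + b w. Euclidean division of a and b by D leaves a remainder of
    bounded size, which a disc covers. As [n] is orthogonal to [v], the half-plane is where b and D
    have the same weak sign, which makes the quotient [j] nonnegative. *)
Lemma codes_halfplane n v w : codes n -> dot n v = 0 -> dot n w < 0 -> v <> 0 ->
  exists r, forall x y, (forall i j, 0 <= j ->
    agree_disc r (act s p (v *~ i + w *~ j) x) (act s p (v *~ i + w *~ j) y)) ->
  x = y.
Proof.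
move=> cn nv nw v0.
pose D := v.1 * w.2 - v.2 * w.1.
have cramer u : D%:~R * dot n u =
    (v.1 * u.2 - v.2 * u.1)%:~R * dot n w + (u.1 * w.2 - u.2 * w.1)%:~R * dot n v.
  by rewrite /dot /D !intrB !intrM; ring.
have D0 : D != 0.
  apply/eqP => D0; apply: v0.
  have cr u : v.1 * u.2 - v.2 * u.1 = 0.
    have := cramer u; rewrite D0 nv mulr0 addr0 mul0r => /esym/eqP.
    by rewrite mulf_eq0 (lt_eqF nw) orbF intr_eq0 => /eqP.
  move: (cr (0, 1)) (cr (1, 0)); case: (v) => a b /= h1 h2.
  by congr pair; lia.
pose M := (`|v.1| + `|v.2| + `|w.1| + `|w.2|)%N.
exists (M + M)%N => x y h; apply: cn => u hu.
pose a := u.1 * w.2 - u.2 * w.1; pose b := v.1 * u.2 - v.2 * u.1.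
pose i := (a %/ D)%Z; pose j := (b %/ D)%Z.
have j0 : 0 <= j.
  have hb : 0 <= b%:~R * D%:~R :> R.
    have := cramer u; rewrite nv mulr0 addr0 -/b => e.
    have D2 : 0 <= D%:~R * D%:~R :> R by nra.
    rewrite -(nmulr_lle0 _ nw) mulrAC -e; nra.
  move: hb; rewrite -intrM ler0z => hb.
  have := divz_eq b D; rewrite -/j; have := modz_ge0 b D0.
  have : (b %% D)%Z < `|D| by exact: ltz_mod.
  by move: (b %% D)%Z j => e j' h1 h2 h3; nia.
pose f := u - (v *~ i + w *~ j).
have fE : f = (u.1 - (v.1 * i + w.1 * j), u.2 - (v.2 * i + w.2 * j)).
  by rewrite [LHS]surjective_pairing /= !(raddfMz fst) !(raddfMz snd) !mulrzz.
have -> : u = f + (v *~ i + w *~ j) by rewrite subrK.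
apply/agree_act/h => //.
have bound (k l : int) : `|k * D| <= `|l * D| -> `|k| <= `|l|.
  by rewrite !normrM ler_pM2r // normr_gt0.
have f1 : f.1 * D = v.1 * (a %% D)%Z + w.1 * (b %% D)%Z.
  have := divz_eq a D; have := divz_eq b D; rewrite -/i -/j fE /= => eb ea.
  have -> : (a %% D)%Z = a - i * D by rewrite {2}ea; ring.
  have -> : (b %% D)%Z = b - j * D by rewrite {2}eb; ring.
  by rewrite /a /b /D; ring.
have f2 : f.2 * D = v.2 * (a %% D)%Z + w.2 * (b %% D)%Z.
  have := divz_eq a D; have := divz_eq b D; rewrite -/i -/j fE /= => eb ea.
  have -> : (a %% D)%Z = a - i * D by rewrite {2}ea; ring.
  have -> : (b %% D)%Z = b - j * D by rewrite {2}eb; ring.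
  by rewrite /a /b /D; ring.
have mod_le k : `|(k %% D)%Z| <= `|D|.
  by rewrite ger0_norm ?modz_ge0 //; apply/ltW/ltz_mod.
have comb (k l k' l' : int) : `|k'| <= `|D| -> `|l'| <= `|D| ->
    `|k * k' + l * l'| <= (`|k| + `|l|) * `|D|.
  move=> hk hl; apply: (le_trans (ler_normD _ _)); rewrite !normrM mulrDl.
  by apply: lerD; exact: ler_wpM2l.
have f1' : `|f.1| <= M%:Z.
  apply: (@le_trans _ _ `|(`|v.1| + `|w.1|)|); last by rewrite /M; lia.
  by apply: bound; rewrite f1 normrM [X in _ <= X * _]ger0_norm ?comb ?addr_ge0.
have f2' : `|f.2| <= M%:Z.
  apply: (@le_trans _ _ `|(`|v.2| + `|w.2|)|); last by rewrite /M; lia.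
  by apply: bound; rewrite f2 normrM [X in _ <= X * _]ger0_norm ?comb ?addr_ge0.
exact: disc_of_box.
Qed.

(** * Disc patterns and expansiveness without the metric *)

Definition ints (r : nat) : seq int := [seq i%:Z - r%:Z | i <- iota 0 (r + r).+1].

Lemma mem_ints r (a : int) : `|a| <= r%:Z -> a \in ints r.
Proof.
move=> ar; apply/mapP; exists `|(a + r%:Z)%R|%N; last by lia.
by rewrite mem_iota; lia.
Qed.

Definition disc_seq (r : nat) : seq (int * int) :=
  [seq u <- [seq (a, b) | a <- ints r, b <- ints r] | ip u u <= (r * r)%N].

Lemma mem_disc_seq r u : (u \in disc_seq r) = (ip u u <= (r * r)%N).
Proof.
rewrite mem_filter; case: lerP => hu; rewrite ?andFb // andTb.
have [u1 u2] := sqrt_le_self hu; rewrite [u]surjective_pairing.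
by apply: allpairs_f; exact: mem_ints.
Qed.

Definition pattern (r : nat) x : (size (disc_seq r)).-tuple A :=
  map_tuple (fun u => c (act s p u x)) (in_tuple (disc_seq r)).

Lemma patternP r x y : pattern r x = pattern r y <-> agree_disc r x y.
Proof.
split=> [/(congr1 val) /= /eq_in_map h u hu|h].
  by apply: h; rewrite mem_disc_seq.
by apply/val_inj/eq_in_map => u; rewrite mem_disc_seq; exact: h.
Qed.

Lemma pattern_lc r : locally_constant (pattern r).
Proof.
have h : locally_constant (fun x => [seq c (act s p u x) | u <- disc_seq r]).
  apply: (@locally_constant_map _ _ _ (fun u => c \o act s p u)) => u.
  by apply: locally_constant_comp; [exact: c_lc | exact: homeo_continuous].
by move=> x; apply: filterS (h x) => y hy; apply: val_inj.
Qed.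

Definition disc_expansive (S : set (int * int)) : Prop :=
  exists r, forall x y,
    (forall u, S u -> agree_disc r (act s p u x) (act s p u y)) -> x = y.

(** A disc centred in the half-plane sticks out of it by at most a constant; moving far inwards by
    [u0] absorbs this. *)
Lemma codes_disc_expansive n : n <> 0 ->
  disc_expansive [set u | dot n u <= 0] <-> codes n.
Proof.
move=> n0; split=> [[r hr] x y h|cn]; last first.
  exists 0%N => x y h; apply: cn => u hu; rewrite -(add0r u).
  by apply/agree_act/(h u) => //; rewrite /ip /= !mulr0.
pose b := `|n.1| * r%:R + `|n.2| * r%:R.
have [u0 hu0] := dot_unbounded (- b) n0.
apply: (@act_inj u0); apply: hr => u hu v hv.
do 2!apply/agree_act; apply: h; rewrite !dotD.
have : dot n v <= b by exact: dot_disc.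
by move: hu => /=; lra.
Qed.

Context (d : T -> T -> R).
Hypothesis d_metric : compatible_metric d.

Lemma metric_agree r : exists2 delta : R, 0 < delta & forall x y,
  d x y <= delta -> agree_disc r x y.
Proof.
have [_ _ _ d_tri d_nbhs] := d_metric.
have d0 x : d x x = 0 by have [_ h _ _ _] := d_metric; apply/h.
have [||N hN] := compact_uniform (P := fun N x =>
    forall y, d x y <= N.+1%:R^-1 -> pattern r y = pattern r x) compactT.
- move=> i j x ij hi y hy; apply: hi; apply: (le_trans hy).
  by rewrite lef_pV2 ?posrE ?ltr0n // ler_nat.
- move=> x _; have /d_nbhs[e e0 he] := pattern_lc r x.
  have [|k] := @ltr_add_invr R 0 (e / 2); first by rewrite divr_gt0.
  rewrite add0r => hk; exists k.
  have : nbhs x [set x' | d x x' < e / 2].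
    by apply/d_nbhs; exists (e / 2) => //; rewrite divr_gt0.
  apply: filterS => x' /= xx' y hy.
  have h1 : d x x' < e by lra.
  have h2 : d x y < e by have := le_lt_trans hy hk; have := d_tri x x' y; lra.
  by rewrite (he _ h1) (he _ h2).
exists N.+1%:R^-1 => [|x y xy]; first by rewrite invr_gt0 ltr0n.
by apply/patternP/esym/hN.
Qed.

(** Near the diagonal, distances are below [delta] by the triangle inequality; a pair off the
    diagonal differs at some (0, j), as do its neighbours, and the disc of radius [|j|] sees this.
    Compactness makes the radius uniform. *)
Lemma agree_metric (delta : R) : 0 < delta -> exists r, forall x y,
  agree_disc r x y -> d x y <= delta.
Proof.
move=> delta0; have [_ d_eq d_sym d_tri d_nbhs] := d_metric.
have [||N hN] := compact_uniform (P := fun N z =>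
    agree_disc N z.1 z.2 -> d z.1 z.2 <= delta) compactTT.
- move=> i j z ij hi hj; apply: hi => u hu; apply: hj.
  by apply: (le_trans hu); rewrite lez_nat leq_mul.
- move=> z _; have [z12|z12] := pselect (z.1 = z.2).
    exists 0%N; have U x : nbhs x [set x' | d x x' < delta / 2].
      by apply/d_nbhs; exists (delta / 2) => //; rewrite divr_gt0.
    near=> z' => _; have h1 : d z.1 z'.1 < delta / 2.
      by near: z'; exact: (@cvg_fst _ _ _ _ _ _ (U z.1)).
    have h2 : d z.2 z'.2 < delta / 2.
      by near: z'; exact: (@cvg_snd _ _ _ _ _ _ (U z.2)).
    by have := d_tri z'.1 z.1 z'.2; rewrite (d_sym z'.1 z.1); rewrite -z12 in h2; lra.
  have [j nj] : exists j : int, ~ agree z.1 z.2 (0, j).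
    apply: contrapT => h; apply: z12; apply: c_gen => j; rewrite -!(act_vertical s p).
    by apply: contrapT => nj; apply: h; exists j.
  exists `|j|%N; apply: filterS (agree_near (0, j) z) => z' [h _] hz'.
  exfalso; apply/nj/h/hz'.
  by rewrite /ip /= mul0r add0r PoszM !abszE -normrM ler_norm.
by exists N => x y; exact: (hN (x, y)).
Unshelve. all: by end_near. Qed.

Lemma disc_expansiveP (S : set (int * int)) :
  (exists2 delta : R, 0 < delta & forall x y,
     (forall u, S u -> d (act s p u x) (act s p u y) <= delta) -> x = y) <->
  disc_expansive S.
Proof.
split=> [[delta /agree_metric[r hr] h]|[r hr]].
  by exists r => x y hxy; apply: h => u /hxy/hr.
have [delta delta0 h] := metric_agree r.
by exists delta => // x y hxy; apply: hr => u /hxy/h.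
Qed.

(** * Expansive lattice vectors and propagation along rays *)

Hypothesis infiniteT : infinite_set [set: T].

Lemma disc_expansive_sub (S S' : set (int * int)) :
  S `<=` S' -> disc_expansive S -> disc_expansive S'.
Proof. by move=> SS' [r h]; exists r => x y xy; apply: h => u /SS'; exact: xy. Qed.

Lemma disc_expansive_codes (S : set (int * int)) n : n <> 0 ->
  disc_expansive S -> (forall u, S u -> dot n u <= 0) -> codes n.
Proof. by move=> n0 hS Sn; apply/codes_disc_expansive => //; exact: disc_expansive_sub hS. Qed.

Definition line w : set (int * int) := [set u | exists j, u = w *~ j].

Definition span_right v w : set (int * int) := [set u | exists i j, 0 <= j /\ u = v *~ i + w *~ j].

Lemma expansiveP w : expansive d (act s p w) <-> disc_expansive (line w).
Proof.
rewrite -disc_expansiveP /expansive; split=> -[delta delta0 h]; exists delta => // x y xy.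
  by apply: h => j; rewrite actM //; apply: xy; exists j.
by apply: h => _ [j ->]; have := xy j; rewrite actM.
Qed.

Lemma right_expansiveP v w :
  right_expansive d (act s p w) (act s p v) <-> disc_expansive (span_right v w).
Proof.
rewrite -disc_expansiveP /right_expansive; split=> -[delta delta0 h]; exists delta => // x y xy.
  apply: h => i j j0; rewrite !actM // !act_apply addrC; apply: xy.
  by exists i, j.
apply: h => _ [i [j [j0 ->]]]; have := xy i j j0.
by rewrite !actM // !act_apply addrC.
Qed.

Lemma left_expansiveP v w :
  left_expansive d (act s p w) (act s p v) <-> disc_expansive (span_right v (- w)).
Proof.
rewrite -disc_expansiveP /left_expansive; split=> -[delta delta0 h]; exists delta => // x y xy.
  apply: h => i j j0; rewrite !actM // !act_apply addrC; apply: xy.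
  by exists i, (- j); rewrite mulNrNz; split=> //; lia.
apply: h => _ [i [j [j0 ->]]]; have j0' : - j <= 0 by lia.
have := xy i (- j) j0'.
by rewrite !actM // !act_apply addrC mulNrz mulrNz.
Qed.

(** Patterns along a forward orbit would determine the point, which happens only in finite spaces.
    With multiples of a single ray as [S], this excludes the vector 0. *)
Lemma one_sided_false (S : set (int * int)) w :
  (forall u, S u -> exists2 j : int, 0 <= j & u = w *~ j) -> ~ disc_expansive S.
Proof.
move=> Sw [r h]; apply: infiniteT.
apply: (one_sided_finite (tau := act s p w) compactT (@pattern_lc r)) => x y xy.
apply: h => u /Sw[j j0 ->]; apply/patternP; have := xy j j0.
by rewrite actM.
Qed.

Lemma expansive_neq0 w : disc_expansive (line w) -> w <> 0.
Proof.
move=> hw w0; apply: (@one_sided_false (line w) w) hw => _ [j ->].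
by exists 0; rewrite // w0 mul0rz.
Qed.

Lemma rot_neq0 (e : R * R) : e <> 0 -> rot e <> 0.
Proof.
case: e => a b e0 [/eqP]; rewrite oppr_eq0 => /eqP b0 a0; apply: e0.
by rewrite a0 b0.
Qed.

Lemma dot_rot w : dot (rot (lat w)) w = 0.
Proof. by rewrite /dot /=; ring. Qed.

Lemma expansive_codes w n : disc_expansive (line w) -> n <> 0 -> dot n w = 0 -> codes n.
Proof.
move=> hw n0 nw; apply: (disc_expansive_codes n0 hw) => _ [j ->].
by rewrite dotMz nw mulr0.
Qed.

Lemma codes_expansive w : w <> 0 -> codes (rot (lat w)) -> codes (- rot (lat w)) ->
  disc_expansive (line w).
Proof.
move=> w0 c1 c2; have [r hr] := codes_line w0 c1 c2.
by exists r => x y h; apply: hr => j; apply: h; exists j.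
Qed.

Definition coding_cone w v : Prop :=
  forall n, n <> 0 -> dot n w <= 0 -> 0 <= dot n v -> codes n.

Lemma ess_weakly_of_cones (P : resolving) v w : disc_expansive (line w) ->
  (P <> QR -> coding_cone w v) -> (P <> PL -> coding_cone v w) ->
  ess_weakly P (act s p w) (act s p v).
Proof.
move=> [r1 h1] hL hR.
(* The guard [b] yields a threshold for each corner even when [P] does not require that corner, so
   one radius can be chosen for all [P]. *)
have corner v' w' (b : Prop) : (b -> coding_cone w' v') ->
    exists r0 : nat, forall (r : nat) x y, b -> (r0 <= r)%N ->
    agree_disc r x y -> agree_disc r (act s p w' x) (act s p w' y) ->
    agree_disc r (act s p (v' + w') x) (act s p (v' + w') y) ->
    agree_disc r (act s p v' x) (act s p v' y).
  move=> hb; have [/hb/disc_corner[r0 hr]|nb] := pselect b; last by exists 0%N.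
  by exists r0 => r x y _; exact: hr.
have [[r2 h2] [r3 h3]] := (corner _ _ _ hL, corner _ _ _ hR).
pose r := (r1 + r2 + r3)%N.
apply: (ess_weakly_of_corners compactT infiniteT (@pattern_lc r)).
- move=> x y xy; apply: h1 => _ [j ->] u ur; have /patternP := xy j.
  rewrite actM //; apply; apply: (le_trans ur).
  by rewrite lez_nat leq_mul // /r -addnA leq_addr.
- exact: actC.
- move=> PQ x y /patternP e1 /patternP e2; rewrite !act_apply addrC => /patternP e3.
  apply/patternP; apply: (h2 r x y) => //.
  by rewrite /r addnAC leq_addl.
- move=> PP x y /patternP e1 /patternP e2; rewrite !act_apply => /patternP e3.
  by apply/patternP; apply: (h3 r x y) => //; rewrite /r leq_addl.
Qed.

(* Agreement along a [w]-ray propagates in the direction [v]. *)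
Definition ray_coding w v : Prop :=
  exists (F : finType) (e : T -> F), [/\ locally_constant e,
    forall x y, (forall j, e (act s p (w *~ j) x) = e (act s p (w *~ j) y)) -> x = y &
    forall x y, (forall j, 0 <= j -> e (act s p (w *~ j) x) = e (act s p (w *~ j) y)) ->
      forall j, 0 <= j -> e (act s p (w *~ j + v) x) = e (act s p (w *~ j + v) y)].

Lemma left_ray_coding v w : ess_weakly PL (act s p w) (act s p v) -> ray_coding w v.
Proof.
move=> /ess_weakly_left_ray[F [e [e1 e2 e3]]]; exists F, e; split=> // x y xy.
  by apply: e2 => j; rewrite actM.
move=> j j0; rewrite -!act_apply -!actM //; apply: e3 => // i i0.
by rewrite !actM //; exact: xy.
Qed.

(** A left ray along [w] is a right ray along [- w], and inferring [x] from [psi x] is a step by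
    [- v]. *)
Lemma right_ray_coding v w : ess_weakly QR (act s p w) (act s p v) ->
  ray_coding (- w) (- v).
Proof.
move=> /ess_weakly_right_ray[F [e [e1 e2 e3]]]; exists F, e; split=> // x y xy.
  by apply: e2 => j; have := xy (- j); rewrite actM // mulNrNz.
move=> j j0; rewrite -!act_apply -[j]opprK mulNrNz -!actM //.
apply: e3; last by lia.
move=> i i0; rewrite !act_apply subrr act0 actM //=.
by have := xy (- i); rewrite mulNrNz; apply; lia.
Qed.

Lemma ray_coding_iter w v : ray_coding w v -> exists (F : finType) (e : T -> F),
  [/\ locally_constant e,
    forall x y, (forall j, e (act s p (w *~ j) x) = e (act s p (w *~ j) y)) -> x = y &
    forall x y, (forall j, 0 <= j -> e (act s p (w *~ j) x) = e (act s p (w *~ j) y)) ->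
      forall (k : nat) j, 0 <= j ->
        e (act s p (w *~ j + v *~ k) x) = e (act s p (w *~ j + v *~ k) y)].
Proof.
move=> [F [e [e1 e2 e3]]]; exists F, e; split=> // x y xy; elim=> [|k ih] j j0.
  by rewrite mulr0z addr0; exact: xy.
have := e3 (act s p (v *~ k) x) (act s p (v *~ k) y) _ j j0.
rewrite !act_apply -addrA (_ : v + v *~ k = v *~ k.+1); last first.
  by rewrite (_ : Posz k.+1 = 1 + k%:Z) ?mulrzDr ?mulr1z //; lia.
by apply=> i i0; rewrite !act_apply; exact: ih.
Qed.

Lemma lc_agree (H : Type) (g : T -> H) : locally_constant g ->
  exists r, forall x y, agree_disc r x y -> g x = g y.
Proof.
move=> lg; have [||N HN] := finite_window (J := setT)
  (f := fun j x => c (expgz s j x)) compactT _ lg.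
- move=> j; apply: (@locally_constant_comp _ _ _ c (expgz s j)) => //.
  exact: homeo_continuous.
- by move=> x y _ _ h; congr g; apply: c_gen => j; exact: h.
exists N => x y xy; apply: HN => // j _ jN; rewrite -!(act_vertical s p).
apply: xy; rewrite /ip /= mul0r add0r PoszM; nia.
Qed.

(** Go back [k] steps of [v] from [w *~ j]. For large [k] the [w]-ray from there, thickened by the
    radius that determines [e], lies in the half-plane; [k] propagation steps carry the agreement to
    [w *~ j]. *)
Lemma ray_coding_codes w v n : ray_coding w v -> dot n w < 0 -> 0 < dot n v -> codes n.
Proof.
move=> /ray_coding_iter[F [e [/lc_agree[r hr] e2 e3]]] nw nv x y xy; apply: e2 => j.
pose b := `|n.1| * r%:R + `|n.2| * r%:R.
pose k := Num.bound `|(b + dot n (w *~ j)) / dot n v|.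
have hk : b + dot n (w *~ j) - k%:R * dot n v <= 0.
  have : `|(b + dot n (w *~ j)) / dot n v| < k%:R by exact: archi_boundP (normr_ge0 _).
  move=> /(le_lt_trans (ler_norm _)); rewrite ltr_pdivrMr //; lra.
pose u0 := w *~ j - v *~ k.
have := e3 (act s p u0 x) (act s p u0 y) _ k 0 (lexx 0).
rewrite !act_apply mulr0z add0r (_ : v *~ k + u0 = w *~ j); last first.
  by rewrite /u0 addrC subrK.
apply=> i i0.
rewrite !act_apply; apply: hr => u ur; apply/agree_act/xy.
have nu : dot n u <= b by exact: dot_disc.
have : i%:~R * dot n w <= 0 by rewrite mulr_ge0_le0 ?ler0z // ltW.
by move: hk; rewrite !dotD dotN !dotMz -[k%:Z%:~R]/(k%:R : R); lra.
Qed.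

Definition opposite v w : Prop := exists a b : int, [/\ 0 < a, 0 < b & v *~ a + w *~ b = 0].

(** As [v *~ a] is [w *~ b] reversed, [a * |j|] propagation steps move the ray back by [b * |j|]
    steps of [w], past [j]; so a forward ray determines the whole [w]-orbit. *)
Lemma ray_coding_opposite w v : ray_coding w v -> ~ opposite v w.
Proof.
move=> /ray_coding_iter[F [e [e1 e2 e3]]] [a [b [a0 b0 ab]]]; apply: infiniteT.
apply: (one_sided_finite (tau := act s p w) compactT e1) => x y xy.
have {}xy (j : int) : 0 <= j -> e (act s p (w *~ j) x) = e (act s p (w *~ j) y).
  by move=> j0; have := xy j j0; rewrite actM.
apply: e2 => j.
have := e3 x y xy (`|a|%N * `|j|%N)%N (j + b * `|j|%N).
have -> : w *~ (j + b * `|j|%N) + v *~ (`|a| * `|j|)%N = w *~ j.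
  rewrite PoszM (gez0_abs (ltW a0)).
  by rewrite mulrzDr -addrA !mulrzA -mulrzDl addrC [w *~ b + _]addrC ab mul0rz add0r.
by apply; nia.
Qed.

Lemma strict_arrow_cone v w : strict_arrow d (act s p v) (act s p w) ->
  [/\ disc_expansive (line w), v <> 0, ~ opposite v w & coding_cone w v \/ coding_cone v w].
Proof.
move=> [/expansiveP hw [[/left_ray_coding hv /right_expansiveP hvw]|
                        [/right_ray_coding hv /left_expansiveP hvw]]]; split=> //.
- move=> v0; apply: (@one_sided_false (span_right v w) w) hvw => _ [i [j [j0 ->]]].
  by exists j; rewrite // v0 mul0rz add0r.
- exact: ray_coding_opposite hv.
- left=> n n0 nw nv; have [nw'|nw'] := eqVneq (dot n w) 0.
    exact: expansive_codes nw'.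
  (* A half-plane bounded by the line of [v] contains [span_right v w]. *)
  have [nv'|nv'] := eqVneq (dot n v) 0.
    apply: (disc_expansive_codes n0 hvw) => _ [i [j [j0 ->]]].
    by rewrite dotD !dotMz nv' mulr0 add0r mulr_ge0_le0 // ler0z.
  by apply: (ray_coding_codes hv); rewrite lt_neqAle ?nw' // eq_sym nv'.
- move=> v0; apply: (@one_sided_false (span_right v (- w)) (- w)) hvw => _ [i [j [j0 ->]]].
  by exists j; rewrite // v0 mul0rz add0r.
- move=> [a [b [a0 b0 ab]]]; apply: (ray_coding_opposite hv); exists a, b.
  by split=> //; rewrite !mulNrz -opprD ab oppr0.
- right=> n n0 nv nw; have [nw'|nw'] := eqVneq (dot n w) 0.
    exact: expansive_codes nw'.
  have [nv'|nv'] := eqVneq (dot n v) 0.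
    apply: (disc_expansive_codes n0 hvw) => _ [i [j [j0 ->]]].
    by rewrite dotD !dotMz nv' mulr0 add0r dotN mulrN oppr_le0 mulr_ge0 // ler0z.
  apply: (ray_coding_codes hv); rewrite dotN ?oppr_lt0 ?oppr_gt0 lt_neqAle ?nv' //.
  by rewrite eq_sym nw'.
Qed.

Definition det v w : int := v.1 * w.2 - v.2 * w.1.

Lemma dot_rot_det v w : dot (rot (lat v)) w = (det v w)%:~R.
Proof. by rewrite /dot /det /= intrB !intrM; ring. Qed.

Lemma det0_positive v w : v <> 0 -> w <> 0 -> det v w = 0 -> ~ opposite v w ->
  exists a b : int, [/\ 0 < a, 0 < b & v *~ a = w *~ b].
Proof.
case: v w => [v1 v2] [w1 w2] v0 w0; rewrite /det /= => vw nopp.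
have mz (k : int * int) (j : int) : k *~ j = (k.1 * j, k.2 * j).
  by rewrite [LHS]surjective_pairing (raddfMz fst) (raddfMz snd) !mulrzz.
have pick (a b : int) : a != 0 -> b != 0 -> v1 * a = w1 * b -> v2 * a = w2 * b ->
    exists a b : int, [/\ 0 < a, 0 < b & (v1, v2) *~ a = (w1, w2) *~ b].
  move=> a0 b0 e1 e2.
  have [[a1 b1]|[[a1 b1]|[[a1 b1]|[a1 b1]]]] : (0 < a /\ 0 < b) \/
    ((a < 0 /\ b < 0) \/ ((0 < a /\ b < 0) \/ (a < 0 /\ 0 < b))) by lia.
  - by exists a, b; split=> //; rewrite !mz /= e1 e2.
  - exists (- a), (- b); rewrite !oppr_gt0; split=> //.
    by rewrite !mz /= !mulrN e1 e2.
  - exfalso; apply: nopp; exists a, (- b); rewrite oppr_gt0; split=> //.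
    by rewrite !mz /= !mulrN e1 e2; congr pair; rewrite subrr.
  - exfalso; apply: nopp; exists (- a), b; rewrite oppr_gt0; split=> //.
    by rewrite !mz /= !mulrN e1 e2; congr pair; rewrite addNr.
have [v10|v10] := eqVneq v1 0; have [w10|w10] := eqVneq w1 0.
- apply: (pick w2 v2); try lia.
    by apply/eqP => w20; apply: w0; rewrite w10 w20.
  by apply/eqP => v20; apply: v0; rewrite v10 v20.
- by exfalso; apply: v0; rewrite v10; congr pair; nia.
- by exfalso; apply: w0; rewrite w10; congr pair; nia.
- by apply: (pick w1 v1) => //; lia.
Qed.

(** Of the two normals [rot (lat v)] and its negative, the one negative on [w] lies in the cone, and
    discs along [span_right v w] fill its half-plane. If [v] and [w] are parallel, the line of [v]
    alone suffices. *)
Lemma cone_half v w : disc_expansive (line w) -> v <> 0 -> ~ opposite v w ->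
  coding_cone w v -> disc_expansive (span_right v w).
Proof.
move=> hw v0 nopp cwv; have w0 := expansive_neq0 hw.
have rv0 := rot_neq0 (lat_neq0 v0); have lrv0 : - rot (lat v) <> 0.
  by move=> /eqP; rewrite oppr_eq0 => /eqP.
have half_codes n : n <> 0 -> dot n v = 0 -> dot n w < 0 -> disc_expansive (span_right v w).
  move=> n0 nv nw; have [|r h] := @codes_halfplane n v w _ nv nw v0.
    by apply: cwv => //; rewrite ?nv // ltW.
  by exists r => x y xy; apply: h => i j j0; apply: xy; exists i, j.
have [vw|vw|vw] := ltgtP (det v w) 0.
- by apply: (half_codes _ rv0); rewrite ?dot_rot // dot_rot_det ltrz0.
- by apply: (half_codes _ lrv0); rewrite dotNl ?dot_rot ?oppr0 // dot_rot_det oppr_lt0 ltr0z.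
have [a [b [a0 b0 ab]]] := det0_positive v0 w0 vw nopp.
have rw : dot (rot (lat v)) w = 0 by rewrite dot_rot_det vw.
apply: (@disc_expansive_sub (line v)).
  by move=> _ [j ->]; exists j, 0; rewrite mulr0z addr0.
apply: codes_expansive => //; first by apply: expansive_codes hw rv0 rw.
by apply: expansive_codes hw lrv0 _; rewrite dotNl rw oppr0.
Qed.

Lemma cone_strict_arrow v w : disc_expansive (line w) -> v <> 0 -> ~ opposite v w ->
  coding_cone w v \/ coding_cone v w -> strict_arrow d (act s p v) (act s p w).
Proof.
move=> hw v0 nopp hc; split; first exact/expansiveP.
case: hc => hc; [left|right]; split.
- by apply: ess_weakly_of_cones.
- by apply/right_expansiveP; exact: cone_half.
- by apply: ess_weakly_of_cones.
apply/left_expansiveP.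
have hN u : disc_expansive (line u) -> disc_expansive (line (- u)).
  by apply: disc_expansive_sub => _ [j ->]; exists (- j); rewrite mulrNz mulNrz opprK.
(* [coding_cone (- w) (- v)] and [coding_cone v w] are the same condition on normals. *)
have := @cone_half (- v) (- w) (hN _ hw).
case.
- by move/eqP; rewrite oppr_eq0 => /eqP.
- move=> [a [b [a0 b0 ab]]]; apply: nopp; exists a, b; split=> //.
  by apply: oppr_inj; rewrite opprD -!mulNrz ab oppr0.
- by move=> n n0; rewrite !dotN => nw nv; apply: hc => //; lra.
move=> r h; exists r => x y xy; apply: h => _ [i [j [j0 ->]]]; apply: xy.
by exists (- i), j; rewrite mulNrz mulrNz.
Qed.

Lemma LR_cones v w : ess_weakly LR (act s p w) (act s p v) ->
  disc_expansive (line w) -> disc_expansive (line v) ->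
  [/\ ~ opposite v w, coding_cone w v & coding_cone v w].
Proof.
move=> lr hw hv.
have hL : ray_coding w v by apply/left_ray_coding/(ess_weakly_sub lr).
have hR : ray_coding (- w) (- v) by apply/right_ray_coding/(ess_weakly_sub lr).
split; first exact: ray_coding_opposite hL.
- move=> n n0 nw nv; have [nw'|nw'] := eqVneq (dot n w) 0.
    exact: expansive_codes nw'.
  have [nv'|nv'] := eqVneq (dot n v) 0; first exact: expansive_codes nv'.
  by apply: (ray_coding_codes hL); rewrite lt_neqAle ?nw' // eq_sym nv'.
- move=> n n0 nv nw; have [nw'|nw'] := eqVneq (dot n w) 0.
    exact: expansive_codes nw'.
  have [nv'|nv'] := eqVneq (dot n v) 0; first exact: expansive_codes nv'.
  apply: (ray_coding_codes hR); rewrite dotN ?oppr_lt0 ?oppr_gt0 lt_neqAle ?nv' //.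
  by rewrite eq_sym nw'.
Qed.

(** * The planar sets in terms of coding normals *)

Definition both_codes : set (R * R) := [set e | e <> 0 /\ (codes (rot e) /\ codes (- rot e))].

Definition some_codes : set (R * R) := [set e | e <> 0 /\ (codes (rot e) \/ codes (- rot e))].

Lemma left_directionP (r : R) : left_direction d s p r <-> codes (rot (1, r)).
Proof.
have n0 : rot (1, r) <> 0 by apply: rot_neq0 => -[/eqP]; rewrite oner_eq0.
rewrite -codes_disc_expansive // -disc_expansiveP /left_direction.
have swap i j x : expgz s j (expgz p i x) = act s p (i, j) x.
  have := expgz_comm j (commute_sym (expgz_comm i (commute_sym sp))).
  by move=> /(congr1 (fun g : homeo T T => g x)) /=.
split=> -[delta delta0 h]; exists delta => // x y xy; apply: h.
  by move=> i j ij; rewrite !swap; apply: xy; rewrite /= /dot /=; lra.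
by move=> [i j] ij; rewrite -!swap; apply: xy; move: ij; rewrite /= /dot /=; lra.
Qed.

Lemma right_directionP (r : R) : right_direction d s p r <-> codes (- rot (1, r)).
Proof.
have n0 : - rot (1, r) <> 0.
  move=> /eqP; rewrite oppr_eq0 => /eqP; apply: rot_neq0 => -[/eqP].
  by rewrite oner_eq0.
rewrite -codes_disc_expansive // -disc_expansiveP /right_direction.
have swap i j x : expgz s j (expgz p i x) = act s p (i, j) x.
  have := expgz_comm j (commute_sym (expgz_comm i (commute_sym sp))).
  by move=> /(congr1 (fun g : homeo T T => g x)) /=.
split=> -[delta delta0 h]; exists delta => // x y xy; apply: h.
  by move=> i j ij; rewrite !swap; apply: xy; rewrite /= /dot /=; lra.
by move=> [i j] ij; rewrite -!swap; apply: xy; move: ij; rewrite /= /dot /=; lra.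
Qed.

(* This is why the planes contain the vectors [(0, b)]. *)
Lemma vertical_codes (n : R * R) : n.2 = 0 -> codes n.
Proof.
move=> n2 x y xy; apply: c_gen => j; rewrite -!(act_vertical s p); apply: xy.
by rewrite /dot /= n2 mulr0 mul0r addr0.
Qed.

(** The slope forgets the sign of [e.1] while [rot e] keeps it, so left and right are exchanged for
    negative [e.1]. *)
Lemma plane_codes (e : R * R) : e <> 0 ->
  (plane_left d s p e <-> e.1 = 0 \/ (0 < e.1 /\ codes (rot e)) \/ (e.1 < 0 /\ codes (- rot e))) /\
  (plane_right d s p e <-> e.1 = 0 \/ (0 < e.1 /\ codes (- rot e)) \/ (e.1 < 0 /\ codes (rot e))).
Proof.
case: e => a b /= e0.
have scale (t a1 b1 a2 b2 : R) : 0 < t -> a2 = t * a1 -> b2 = t * b1 ->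
    codes (a1, b1) <-> codes (a2, b2).
  move=> t0 -> ->; split; first exact: codes_scale.
  move=> /(codes_scale (t := t^-1)); rewrite invr_gt0 => /(_ t0).
  by rewrite /= !mulKf // gt_eqF.
rewrite /plane_left /plane_right /=.
have [a0|[a0|a0]] : a < 0 \/ (0 < a \/ a = 0) by case: (ltgtP a 0); auto.
- have an0 : a != 0 by rewrite lt_eqF.
  have E1 : codes (rot (1, b / a)) <-> codes (- rot (a, b)).
    by apply: (scale (- a)); rewrite ?oppr_gt0 //=; field.
  have E2 : codes (- rot (1, b / a)) <-> codes (rot (a, b)).
    by apply: (scale (- a)); rewrite ?oppr_gt0 //=; field.
  rewrite left_directionP right_directionP E1 E2.
  by split; split; intuition; exfalso; clear e0; lra.
- have an0 : a != 0 by rewrite gt_eqF.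
  have E1 : codes (rot (1, b / a)) <-> codes (rot (a, b)).
    by apply: (scale a) => //=; field.
  have E2 : codes (- rot (1, b / a)) <-> codes (- rot (a, b)).
    by apply: (scale a) => //=; field.
  rewrite left_directionP right_directionP E1 E2.
  by split; split; intuition; exfalso; clear e0; lra.
- by split; split; intuition.
Qed.

Lemma plane_both : plane_right d s p `&` plane_left d s p = both_codes.
Proof.
apply/seteqP; split=> e.
  move=> [[e0 hr] [_ hl]]; have {}e0 : e <> 0 := e0; split=> //.
  have [Pl Pr] := plane_codes e0.
  have /Pl h1 : plane_left d s p e by split.
  have /Pr h2 : plane_right d s p e by split.
  case: h1 => [e1|h1].
    by split; apply: vertical_codes; rewrite /= e1 ?oppr0.
  case: h1 h2 => -[e1 c1] [e2|[[e2 c2]|[e2 c2]]] //; by [rewrite e2 ltxx in e1 | lra].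
move=> [e0 [c1 c2]]; have [Pl Pr] := plane_codes e0.
split; [apply/Pr|apply/Pl];
  have [e1|[e1|e1]] : e.1 < 0 \/ (0 < e.1 \/ e.1 = 0) by case: (ltgtP e.1 0); auto.
  all: by auto.
Qed.

Lemma plane_some : plane_right d s p `|` plane_left d s p = some_codes.
Proof.
apply/seteqP; split=> e.
  move=> h; have e0 : e <> 0 by case: h => -[].
  split=> //; have [Pl Pr] := plane_codes e0; case: h.
    by move=> /Pr[e1|[[e1 c1]|[e1 c1]]]; auto; left; apply: vertical_codes.
  by move=> /Pl[e1|[[e1 c1]|[e1 c1]]]; auto; left; apply: vertical_codes.
move=> [e0 h]; have [Pl Pr] := plane_codes e0.
have [e1|[e1|e1]] : e.1 < 0 \/ (0 < e.1 \/ e.1 = 0) by case: (ltgtP e.1 0); auto.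
  all: case: h => h.
- by left; apply/Pr; auto.
- by right; apply/Pl; auto.
- by right; apply/Pl; auto.
- by left; apply/Pr; auto.
- by left; apply/Pr; auto.
- by left; apply/Pr; auto.
Qed.

Lemma codes_rot_near e : e <> 0 -> codes (rot e) -> \forall m \near e, codes (rot m).
Proof.
move=> e0 ce; have := codes_near (rot_neq0 e0) ce.
have cr : continuous rot.
  have c1 : continuous (fun z : R * R => - z.2) by move=> z; apply: cvgN; exact: cvg_snd.
  have c2 : continuous (fun z : R * R => z.1) by move=> z; exact: cvg_fst.
  by move=> z; exact: (cvg_pair (c1 z) (c2 z)).
exact: (cr e).
Qed.

Lemma codes_oprot_near e : e <> 0 -> codes (- rot e) -> \forall m \near e, codes (- rot m).
Proof.
move=> e0 ce; have e0' : - e <> 0 by move=> /eqP; rewrite oppr_eq0 => /eqP.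
have rotN z : - rot z = rot (- z) by [].
rewrite rotN in ce; have cN : continuous (fun z : R * R => - z).
  by move=> z; apply: cvgN; exact: cvg_id.
by have := cN e _ (codes_rot_near e0' ce).
Qed.

Lemma rot_scale (t : R) e m1 m2 : 0 < t -> m1 = t * e.1 -> m2 = t * e.2 ->
  codes (rot e) -> codes (- rot e) -> codes (rot (m1, m2)) /\ codes (- rot (m1, m2)).
Proof.
move=> t0 -> -> c1 c2; split.
  have := codes_scale t0 c1; rewrite /= mulrN; exact.
by have := codes_scale t0 c2; rewrite /= !mulrN; exact.
Qed.

Lemma both_codes_box e : both_codes e -> exists2 eps : R, 0 < eps &
  forall m1 m2, `|m1 - e.1| < eps -> `|m2 - e.2| < eps -> both_codes (m1, m2).
Proof.
move=> [e0 [c1 c2]].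
have n0 : \forall m \near e, m != 0.
  have e1 : 0 < `|e| by rewrite normr_gt0; apply/eqP.
  near=> m; rewrite -normr_gt0; near: m.
  exact: (cvgr_gt _ (@norm_continuous _ _ e) _ e1).
have [eps eps0 h] : exists2 eps : R, 0 < eps &
    forall m, `|m.1 - e.1| < eps -> `|m.2 - e.2| < eps ->
      m != 0 /\ (codes (rot m) /\ codes (- rot m)).
  apply: near_box; near=> m; split; first by near: m.
  split; near: m; [exact: codes_rot_near | exact: codes_oprot_near].
exists eps => // m1 m2 h1 h2; have [/eqP ? ?] := h (m1, m2) h1 h2.
by split.
Unshelve. all: by end_near. Qed.

Lemma both_codes_scale (t : R) e : 0 < t -> both_codes e -> both_codes (t * e.1, t * e.2).
Proof.
move=> t0 [e0 [c1 c2]]; split; last exact: (rot_scale t0).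
move=> [/eqP + /eqP]; rewrite !mulf_eq0 gt_eqF //= => /eqP h1 /eqP h2; apply: e0.
by rewrite [e]surjective_pairing h1 h2.
Qed.

Lemma both_codesP w : both_codes (lat w) <-> disc_expansive (line w).
Proof.
split=> [[w0 [c1 c2]]|hw].
  apply: codes_expansive => // w0'; apply: w0.
  by rewrite w0' /lat /=.
have w0 := lat_neq0 (expansive_neq0 hw); split=> //; split.
  exact: (expansive_codes hw (rot_neq0 w0) (dot_rot w)).
apply: (expansive_codes hw); first by move=> /eqP; rewrite oppr_eq0 => /eqP/(rot_neq0 w0).
by rewrite dotNl dot_rot oppr0.
Qed.

(** [both_codes] is an open cone, so far out along the ray of [e] it has room for any error [C], in
    particular for rounding to lattice points. *)
Lemma both_codes_far e (C : R) : both_codes e -> 0 < C -> exists2 N : nat, (0 < N)%N &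
  forall f : R * R, `|f.1 - N%:R * e.1| <= C -> `|f.2 - N%:R * e.2| <= C ->
  forall t, 0 <= t <= 1 -> both_codes ((1 - t) * e.1 + t * f.1, (1 - t) * e.2 + t * f.2).
Proof.
move=> he C0; have [eps eps0 h] := both_codes_box he.
have [N hN] : exists N : nat, C < N%:R * eps.
  exists (Num.bound `|C / eps|); have : `|C / eps| < (Num.bound `|C / eps|)%:R.
    exact: archi_boundP (normr_ge0 _).
  by move=> /(le_lt_trans (ler_norm _)); rewrite ltr_pdivrMr.
have N0 : 0 < N%:R :> R by rewrite -(pmulr_lgt0 _ eps0) (lt_trans _ hN).
exists N => [|f f1 f2 t /andP[t0 t1]]; first by rewrite -(ltr0n R).
(* If [f] were exactly N e, the point of the segment would be q e; dividing by [q] brings it within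
   [eps] of [e]. *)
pose q := 1 - t + t * N%:R.
have q0 : 0 < q.
  rewrite /q; have [t0'|t0'] := ltP 0 t; first by have := mulr_gt0 t0' N0; lra.
  have tz : t = 0 by lra.
  by rewrite tz mul0r; lra.
have close (x y : R) : `|y - N%:R * x| <= C -> `|((1 - t) * x + t * y) / q - x| < eps.
  move=> xy; have -> : ((1 - t) * x + t * y) / q - x = t * (y - N%:R * x) / q.
    by rewrite /q; field; rewrite gt_eqF.
  rewrite !normrM normfV (gtr0_norm q0) (ger0_norm t0) ltr_pdivrMr //.
  have : t * `|y - N%:R * x| <= t * C by exact: ler_wpM2l.
  rewrite /q; have [t0'|t0'] := ltP 0 t; last first.
    have tz : t = 0 by lra.
    by rewrite tz !mul0r; lra.
  have : t * C < t * (N%:R * eps) by rewrite ltr_pM2l.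
  have : 0 <= (1 - t) * eps by rewrite mulr_ge0 ?subr_ge0 // ltW.
  lra.
have := both_codes_scale q0 (h _ _ (close _ _ f1) (close _ _ f2)).
by rewrite /= ![q * (_ / q)]mulrC !divfK // gt_eqF.
Qed.

Lemma lattice_point_component e : both_codes e ->
  exists2 w, disc_expansive (line w) & connected_component both_codes e (lat w).
Proof.
move=> he; have [N N0 h] := both_codes_far he ltr01.
pose w : int * int := (Num.floor (N%:R * e.1), Num.floor (N%:R * e.2)).
have fl (x : R) : `|(Num.floor x)%:~R - x| <= 1.
  by have := floor_itv x; rewrite ler_norml intrD => /andP[h1 h2]; lra.
have comp : connected_component both_codes e (lat w).
  by apply: segment_component; apply: h; exact: fl.
by exists w => //; apply/both_codesP/(connected_component_sub comp).
Qed.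

(* A line that fails to code misses [both_codes], so it separates its components. *)
Lemma codes_component_cone v w : connected_component both_codes (lat w) (lat v) -> coding_cone w v.
Proof.
move=> comp n n0 nw nv; apply: contrapT => ncn.
have skip z : both_codes z -> n.1 * z.1 + n.2 * z.2 <> 0.
  by move=> [z0 [c1 c2]] nz; apply: ncn; apply: codes_orthogonal nz _ _.
have bw := connected_component_sub (connected_component_sym comp).
have bv := connected_component_sub comp.
have nw' : dot n w < 0 by rewrite lt_neqAle nw andbT; apply/eqP; exact: skip bw.
have nv' : 0 < dot n v by rewrite lt_neqAle nv andbT eq_sym; apply/eqP; exact: skip bv.
by have [z bz] := component_crosses comp nw' nv'; exact: skip.
Qed.

(** * Segments between lattice vectors *)

Definition seg w v (t : R) : R * R :=
  ((1 - t) * (lat w).1 + t * (lat v).1, (1 - t) * (lat w).2 + t * (lat v).2).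

Lemma dot_seg n w v t :
  n.1 * (seg w v t).1 + n.2 * (seg w v t).2 = (1 - t) * dot n w + t * dot n v.
Proof. by rewrite /seg /dot /=; ring. Qed.

Lemma det0_seg v w t : v <> 0 -> w <> 0 -> det v w = 0 -> ~ opposite v w ->
  0 <= t <= 1 -> seg w v t <> 0.
Proof.
move=> v0 w0 vw nopp /andP[t0 t1] [e1 e2].
have [a [b [a0 b0 ab]]] := det0_positive v0 w0 vw nopp.
have a0' : 0 < a%:~R :> R by rewrite ltr0z.
have b0' : 0 < b%:~R :> R by rewrite ltr0z.
have w00 (x y : int) : x * a = y * b ->
    (1 - t) * y%:~R + t * x%:~R = 0 :> R -> y = 0.
  clear v0 w0 ab; move=> /(congr1 (fun i : int => i%:~R : R)); rewrite !intrM => xy h.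
  have : ((1 - t) * a%:~R + t * b%:~R) * y%:~R = 0 :> R.
    transitivity (a%:~R * ((1 - t) * y%:~R + t * x%:~R) +
      t * (y%:~R * b%:~R - x%:~R * a%:~R) : R); first by ring.
    by rewrite h xy subrr !mulr0 addr0.
  move/eqP; rewrite mulf_eq0 intr_eq0 gt_eqF /= => [/eqP //|].
  have [t0'|t0'] := ltP 0 t.
    have : 0 <= (1 - t) * a%:~R by rewrite mulr_ge0 ?subr_ge0 // ltW.
    by have := mulr_gt0 t0' b0'; lra.
  have tz : t = 0 by lra.
  by rewrite tz mul0r; lra.
apply: w0; rewrite [w]surjective_pairing.
have h1 : v.1 * a = w.1 * b by have := congr1 fst ab; rewrite !(raddfMz fst) !mulrzz.
have h2 : v.2 * a = w.2 * b by have := congr1 snd ab; rewrite !(raddfMz snd) !mulrzz.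
by rewrite (w00 _ _ h1 e1) (w00 _ _ h2 e2).
Qed.

Lemma seg_neq0 v w t : v <> 0 -> w <> 0 -> ~ opposite v w ->
  0 <= t <= 1 -> seg w v t <> 0.
Proof.
move=> v0 w0 nopp t01; have [vw|vw] := eqVneq (det v w) 0; first exact: det0_seg.
move=> s0; have h n : (1 - t) * dot n w + t * dot n v = 0.
  by rewrite -dot_seg s0 /= !mulr0 addr0.
have vw' : (det v w)%:~R != 0 :> R by rewrite intr_eq0.
have := h (rot (lat v)); rewrite dot_rot mulr0 addr0 dot_rot_det => /eqP.
rewrite mulf_eq0 (negbTE vw') orbF subr_eq0 => /eqP t1.
have := h (rot (lat w)); rewrite -t1 dot_rot mulr0 add0r mul1r dot_rot_det.
have -> : det w v = - det v w by rewrite /det; ring.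
by rewrite mulrNz => /eqP; rewrite oppr_eq0 (negbTE vw').
Qed.

Lemma cone_seg_sign (t a b : R) : (1 - t) * a + t * b = 0 -> 0 <= t <= 1 ->
  (a <= 0 /\ 0 <= b) \/ (0 <= a /\ b <= 0).
Proof. by move=> h /andP[t0 t1]; nra. Qed.

(** The normal [rot (seg w v t)] vanishes at a point between [w] and [v], so it takes opposite weak
    signs on them; it or its negative lies in the given cone. *)
Lemma cone_seg v w t : disc_expansive (line w) -> v <> 0 -> ~ opposite v w ->
  0 <= t <= 1 -> coding_cone w v \/ coding_cone v w -> some_codes (seg w v t).
Proof.
move=> hw v0 nopp t01 hc; have s0 := seg_neq0 v0 (expansive_neq0 hw) nopp t01.
split=> //; have r0 := rot_neq0 s0.
have r0' : - rot (seg w v t) <> 0 by move=> /eqP; rewrite oppr_eq0 => /eqP.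
have h : (1 - t) * dot (rot (seg w v t)) w + t * dot (rot (seg w v t)) v = 0.
  by rewrite -dot_seg /=; ring.
have [[a b]|[a b]] := cone_seg_sign h t01; case: hc => hc.
- by left; apply: hc.
- by right; apply: hc => //; rewrite dotNl ?oppr_le0 ?oppr_ge0.
- by right; apply: hc => //; rewrite dotNl ?oppr_le0 ?oppr_ge0.
- by left; apply: hc.
Qed.

Lemma cones_seg v w t : disc_expansive (line w) -> v <> 0 -> ~ opposite v w ->
  0 <= t <= 1 -> coding_cone w v -> coding_cone v w -> both_codes (seg w v t).
Proof.
move=> hw v0 nopp t01 c1 c2; have s0 := seg_neq0 v0 (expansive_neq0 hw) nopp t01.
split=> //; have r0 := rot_neq0 s0.
have r0' : - rot (seg w v t) <> 0 by move=> /eqP; rewrite oppr_eq0 => /eqP.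
have h : (1 - t) * dot (rot (seg w v t)) w + t * dot (rot (seg w v t)) v = 0.
  by rewrite -dot_seg /=; ring.
have [[a b]|[a b]] := cone_seg_sign h t01; split.
- exact: c1.
- by apply: c2 => //; rewrite dotNl ?oppr_le0 ?oppr_ge0.
- exact: c2.
- by apply: c1 => //; rewrite dotNl ?oppr_le0 ?oppr_ge0.
Qed.

Lemma some_codes_scale (k : R) e : k != 0 -> e <> 0 ->
  some_codes (k * e.1, k * e.2) -> some_codes e.
Proof.
move=> k0 e0 [_ ce]; split=> //; have [kneg|kpos|k00] := ltgtP k 0.
- have mK (x : R) : (- k)^-1 * (k * x) = - x by rewrite invrN mulNr mulKf.
  have k' : 0 < (- k)^-1 by rewrite invr_gt0 oppr_gt0.
  case: ce => /(codes_scale k'); rewrite /= !mulrN !mK; first by right.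
  by rewrite !opprK; left.
- case: ce => /(codes_scale (t := k^-1)); rewrite invr_gt0 => /(_ kpos);
    rewrite /= !mulrN !mulKf // => ce; [by left|by right].
- by rewrite k00 eqxx in k0.
Qed.

(** [some_codes] is stable under all nonzero factors, negative ones included. A point missing from
    it thus removes a whole line through 0, which would separate [w] from [v]. *)
Lemma some_codes_seg v w t : ~ opposite v w -> v <> 0 -> w <> 0 ->
  connected_component some_codes (lat w) (lat v) ->
  0 <= t <= 1 -> some_codes (seg w v t).
Proof.
move=> nopp v0 w0 comp t01; have s0 := seg_neq0 v0 w0 nopp t01.
apply: contrapT => ns; pose n := rot (seg w v t).
have skip z : some_codes z -> n.1 * z.1 + n.2 * z.2 <> 0.
  move=> cz nz; apply: ns; have n0 : n <> 0 by exact: rot_neq0.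
  have nz' : z.1 * n.1 + z.2 * n.2 = 0 by rewrite -nz; ring.
  have [k zE] := orthogonal_rot n0 nz'.
  have k0 : - k != 0.
    rewrite oppr_eq0; apply/eqP => k0; case: cz => z0 _; apply: z0.
    by rewrite zE k0 !mul0r.
  apply: (some_codes_scale k0) => //; rewrite !mulNr.
  by move: cz; rewrite zE /n /= !mulrN.
have bw := connected_component_sub (connected_component_sym comp).
have bv := connected_component_sub comp.
have nw : dot n w <> 0 by exact: skip bw.
have nv : dot n v <> 0 by exact: skip bv.
have h : (1 - t) * dot n w + t * dot n v = 0 by rewrite -dot_seg /=; ring.
have [[a b]|[a b]] := cone_seg_sign h t01.
  have a' : dot n w < 0 by rewrite lt_neqAle a andbT; apply/eqP.
  have b' : 0 < dot n v by rewrite lt_neqAle b andbT eq_sym; apply/eqP.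
  by have [z bz] := component_crosses comp a' b'; exact: skip.
have a' : 0 < dot n w by rewrite lt_neqAle a andbT eq_sym; apply/eqP.
have b' : dot n v < 0 by rewrite lt_neqAle b andbT; apply/eqP.
have [z bz] := component_crosses (connected_component_sym comp) b' a'.
exact: skip.
Qed.

Lemma cone_of_seg v w : (forall t, 0 <= t <= 1 -> both_codes (seg w v t)) -> coding_cone w v.
Proof.
move=> h n n0 nw nv.
suff [t t01 nt] : exists2 t, 0 <= t <= 1 & (1 - t) * dot n w + t * dot n v = 0.
  have [s0 [c1 c2]] := h t t01.
  by apply: (codes_orthogonal n0 s0) => //; rewrite dot_seg.
have [nw'|nw'] := eqVneq (dot n w) 0.
  by exists 0; rewrite ?lexx ?ler01 // nw' mulr0 mul0r addr0.
have {}nw : dot n w < 0 by rewrite lt_neqAle nw'.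
have D0 : 0 < dot n v - dot n w by clear n0; lra.
exists (- dot n w / (dot n v - dot n w)); last by field; rewrite gt_eqF.
apply/andP; split; first by rewrite divr_ge0 ?oppr_ge0 ?ltW.
by rewrite ler_pdivrMr // mul1r; clear n0; lra.
Qed.

(* Leads to the vectors opposite to [w], which no segment avoiding 0 joins to [w]. *)
Lemma transverse_neighbour w : disc_expansive (line w) ->
  exists w0, [/\ det w w0 != 0, disc_expansive (line w0) & coding_cone w w0].
Proof.
move=> hw; have w00 := expansive_neq0 hw; have /both_codesP bw := hw.
pose C : R := (`|w.1| + `|w.2| + 1)%:~R.
have [|N N0 h] := both_codes_far bw (C := C); first by rewrite ltr0z; lia.
pose w0 := w *~ N + (- w.2, w.1).
have w0E : w0 = (w.1 * N - w.2, w.2 * N + w.1).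
  by rewrite [LHS]surjective_pairing /= (raddfMz fst) (raddfMz snd) !mulrzz.
have hseg t : 0 <= t <= 1 -> both_codes (seg w w0 t).
  apply: (h (lat w0)); rewrite w0E /= ?intrB ?intrD intrM -[N%:Z%:~R]/(N%:R : R).
    rewrite mulrC addrAC subrr add0r normrN -intr_norm ler_int; lia.
  rewrite mulrC addrAC subrr add0r -intr_norm ler_int; lia.
exists w0; split; last exact: cone_of_seg.
  have -> : det w w0 = ip w w by rewrite w0E /det /ip /=; ring.
  apply/eqP => ww; apply: w00; rewrite [w]surjective_pairing.
  have : 0 <= w.1 * w.1 by nia.
  have : 0 <= w.2 * w.2 by nia.
  move: ww; rewrite /ip => e1 e2 e3.
  have /eqP : w.1 * w.1 = 0 by lia.
  have /eqP : w.2 * w.2 = 0 by lia.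
  by rewrite !mulf_eq0 !orbb => /eqP -> /eqP ->.
apply/both_codesP; have := hseg 1; rewrite /seg subrr !mul0r !add0r !mul1r.
by rewrite -surjective_pairing; apply; rewrite ler01 lexx.
Qed.

Lemma oppr_rot e : - rot e = (e.2, - e.1).
Proof. by rewrite [LHS]surjective_pairing /= opprK. Qed.

(** * Subdividing a segment by the side that codes *)

Section Subdivision.
Context (v w : int * int).
Hypothesis vw : det w v != 0.

(* The factor [det w v] fixes the sign: a normal that is negative before and
   nonnegative after some point of the segment is a positive multiple of [nu t]. *)
Definition nu (t : R) : R * R :=
  ((det w v)%:~R * (rot (seg w v t)).1, (det w v)%:~R * (rot (seg w v t)).2).

Let D : R := (det w v)%:~R.

Let D_neq0 : D != 0. Proof. by rewrite intr_eq0. Qed.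

Let DE : D = (lat w).1 * (lat v).2 - (lat w).2 * (lat v).1.
Proof. by rewrite /D /det intrB !intrM. Qed.

Lemma cross_seg r0 t :
  (rot (seg w v t)).1 * (seg w v r0).1 + (rot (seg w v t)).2 * (seg w v r0).2 = D * (r0 - t).
Proof. by rewrite DE /seg /=; ring. Qed.

Lemma independent_seg_neq0 t : seg w v t <> 0.
Proof.
move=> s0; have := cross_seg (t + 1) t; rewrite s0 /= oppr0 !mul0r addr0.
have -> : t + 1 - t = 1 by ring.
by rewrite mulr1 => /esym/eqP; apply/negP.
Qed.

Lemma nu_root n r0 r1 : r0 <= r1 ->
  n.1 * (seg w v r0).1 + n.2 * (seg w v r0).2 < 0 ->
  0 <= n.1 * (seg w v r1).1 + n.2 * (seg w v r1).2 ->
  exists t k, [/\ r0 <= t <= r1, 0 < k & n = (k * (nu t).1, k * (nu t).2)].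
Proof.
move=> ss' fs fs'; pose a := dot n w; pose b := dot n v.
have fE r : n.1 * (seg w v r).1 + n.2 * (seg w v r).2 = a + r * (b - a).
  by rewrite dot_seg /a /b; ring.
rewrite !fE in fs fs'.
have ba : 0 < b - a.
  rewrite ltNge; apply/negP => ba; have r01 : 0 <= r1 - r0 by rewrite subr_ge0.
  by have := mulr_ge0_le0 r01 ba; lra.
pose t := - a / (b - a).
have tE : t * (b - a) = - a by rewrite /t mulfVK // gt_eqF.
have st : r0 < t by rewrite -(ltr_pM2r ba) tE; lra.
have ts' : t <= r1 by rewrite -(ler_pM2r ba) tE; lra.
have [|k nE] := @orthogonal_rot n _ (@independent_seg_neq0 t).
  by rewrite fE tE subrr.
have kD : 0 < k * D.
  have : a + r0 * (b - a) < 0 by [].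
  rewrite -fE nE /=.
  have -> : k * - (seg w v t).2 * (seg w v r0).1 + k * (seg w v t).1 * (seg w v r0).2 =
      k * ((rot (seg w v t)).1 * (seg w v r0).1 + (rot (seg w v t)).2 * (seg w v r0).2).
    by rewrite /=; ring.
  by rewrite cross_seg mulrA nmulr_llt0 // subr_lt0.
exists t, (k / D); split; first by rewrite ltW.
  have : 0 < D * D by rewrite -expr2 exprn_even_gt0.
  by move=> D2; rewrite -(pmulr_lgt0 _ D2) mulrACA mulVf // ?mulr1.
by rewrite /nu -/D !mulrA !divfK.
Qed.

Lemma nu_both t : codes (nu t) -> codes (- nu t) -> both_codes (seg w v t).
Proof.
move=> c1 c2; have s0 := @independent_seg_neq0 t; split=> //.
have [D0|D0|D0] := ltgtP D 0; last by move: D_neq0; rewrite D0 eqxx.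
  have D0' : 0 < (- D)^-1 by rewrite invr_gt0 oppr_gt0.
  have mK (x : R) : (- D)^-1 * (D * x) = - x by rewrite invrN mulNr mulKf.
  have := codes_scale D0' c1; have := codes_scale D0' c2.
  rewrite /nu /= -/D !mulrN !mK ?opprK => h1 h2.
  by split; [exact: h1 | rewrite oppr_rot; exact: h2].
have D0' : 0 < D^-1 by rewrite invr_gt0.
have := codes_scale D0' c1; have := codes_scale D0' c2.
by rewrite /nu /= -/D !mulrN !mulKf.
Qed.

Lemma nu_some t : some_codes (seg w v t) -> codes (nu t) \/ codes (- nu t).
Proof.
move=> [_ h]; have [D0|D0|D0] := ltgtP D 0; last by move: D_neq0; rewrite D0 eqxx.
  have D0' : 0 < - D by rewrite oppr_gt0.
  case: h => /(codes_scale D0') h; [right|left].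
    by rewrite [- nu t]surjective_pairing /= -!mulNr; exact: h.
  by move: h; rewrite /= !mulrNN; exact.
case: h => /(codes_scale D0) h; [left; exact: h|right].
by rewrite [- nu t]surjective_pairing /= -!mulrN; exact: h.
Qed.

Lemma nu_cone u u' (l l' r0 r1 : R) : 0 < l -> 0 < l' -> r0 <= r1 ->
  lat u = (l * (seg w v r0).1, l * (seg w v r0).2) ->
  lat u' = (l' * (seg w v r1).1, l' * (seg w v r1).2) -> disc_expansive (line u) ->
  (forall t, r0 <= t <= r1 -> codes (nu t)) \/ (forall t, r0 <= t <= r1 -> codes (- nu t)) ->
  coding_cone u u' \/ coding_cone u' u.
Proof.
move=> l0 l0' ss' uE uE' hu hc.
have du n : dot n u = l * (n.1 * (seg w v r0).1 + n.2 * (seg w v r0).2).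
  rewrite (_ : dot n u = n.1 * (lat u).1 + n.2 * (lat u).2) // uE /=; ring.
have du' n : dot n u' = l' * (n.1 * (seg w v r1).1 + n.2 * (seg w v r1).2).
  rewrite (_ : dot n u' = n.1 * (lat u').1 + n.2 * (lat u').2) // uE' /=; ring.
case: hc => hc; [left|right] => n n0 h1 h2.
  have [nu0|nu0] := eqVneq (dot n u) 0; first exact: expansive_codes nu0.
  have nu1 : dot n u < 0 by rewrite lt_neqAle nu0.
  move: nu1 h2; rewrite du du' pmulr_rlt0 // pmulr_rge0 // => nu1 nu2.
  have [t [k [tt k0 ->]]] := nu_root ss' nu1 nu2.
  by apply: codes_scale => //; exact: hc.
have [nu0|nu0] := eqVneq (dot n u) 0; first exact: expansive_codes nu0.
have nu1 : dot (- n) u < 0 by rewrite dotNl oppr_lt0 lt_neqAle eq_sym nu0.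
have nu2 : 0 <= dot (- n) u' by rewrite dotNl oppr_ge0.
move: nu1 nu2; rewrite du du' pmulr_rlt0 // pmulr_rge0 // => nu1 nu2.
have [t [k [tt k0 nE]]] := nu_root ss' nu1 nu2.
have -> : n = (k * (- nu t).1, k * (- nu t).2).
  by rewrite -[n]opprK nE /= !mulrN.
by apply: codes_scale => //; exact: hc.
Qed.

(** If [u] and [u'] were opposite, the weighted mean [t] of [r0] and [r1] would give
    [seg w v t = 0], against the independence of [w] and [v]. *)
Lemma seg_not_opposite u u' (l l' r0 r1 : R) : 0 < l -> 0 < l' ->
  lat u = (l * (seg w v r0).1, l * (seg w v r0).2) ->
  lat u' = (l' * (seg w v r1).1, l' * (seg w v r1).2) -> ~ opposite u' u.
Proof.
move=> l0 l0' uE uE' [a [b [a0 b0 ab]]].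
have a0' : 0 < a%:~R * l' :> R by rewrite mulr_gt0 ?ltr0z.
have b0' : 0 < b%:~R * l :> R by rewrite mulr_gt0 ?ltr0z.
pose q := a%:~R * l' + b%:~R * l; have q0 : 0 < q by rewrite addr_gt0.
pose t := (a%:~R * l' * r1 + b%:~R * l * r0) / q.
apply: (@independent_seg_neq0 t).
have key (x y : R) (i j : int) : i * a + j * b = 0 ->
    i%:~R = l' * ((1 - r1) * x + r1 * y) -> j%:~R = l * ((1 - r0) * x + r0 * y) ->
    (1 - t) * x + t * y = 0.
  move=> /(congr1 (fun i : int => i%:~R : R)); rewrite intrD !intrM => ij ix jx.
  have -> : (1 - t) * x + t * y = (i%:~R * a%:~R + j%:~R * b%:~R) / q.
    by rewrite ix jx /t /q; field; rewrite gt_eqF.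
  by rewrite ij mul0r.
have [h1 h2] : u'.1 * a + u.1 * b = 0 /\ u'.2 * a + u.2 * b = 0.
  have := congr1 fst ab; have := congr1 snd ab.
  by rewrite /= !(raddfMz fst) !(raddfMz snd) !mulrzz => -> ->.
move: uE uE' => [e1 e2] [e1' e2']; rewrite /seg.
by rewrite (key _ _ _ _ h1 e1' e1) (key _ _ _ _ h2 e2' e2).
Qed.

End Subdivision.

Lemma nu_continuous v w : continuous (nu v w).
Proof.
have cl (a b : R) : continuous (fun t : R => (1 - t) * a + t * b).
  move=> t; apply: cvgD; apply: cvgM; (try exact: cvg_cst); (try exact: cvg_id).
  by apply: cvgB; [exact: cvg_cst | exact: cvg_id].
have c1 : continuous (fun t => (nu v w t).1).
  by move=> t; apply: cvgM; [exact: cvg_cst | apply: cvgN; exact: cl].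
have c2 : continuous (fun t => (nu v w t).2).
  by move=> t; apply: cvgM; [exact: cvg_cst | exact: cl].
by move=> t; exact: (cvg_pair (c1 t) (c2 t)).
Qed.

Lemma nu_neq0 v w t : det w v != 0 -> nu v w t <> 0.
Proof.
move=> vw [/eqP h2 /eqP h1]; apply: (independent_seg_neq0 vw (t := t)).
have e2 : (seg w v t).2 = 0.
  by apply/eqP; move: h2; rewrite mulf_eq0 intr_eq0 (negbTE vw) oppr_eq0.
have e1 : (seg w v t).1 = 0.
  by apply/eqP; move: h1; rewrite mulf_eq0 intr_eq0 (negbTE vw).
by rewrite [seg _ _ _]surjective_pairing e1 e2.
Qed.

(** A Lebesgue number for the cover of [0, 1] by the open sets where [nu v w t], respectively its
    negative, codes. *)
Lemma seg_grid v w : det w v != 0 -> (forall t : R, 0 <= t <= 1 -> some_codes (seg w v t)) ->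
  exists N : nat, forall t, 0 <= t <= 1 ->
    (forall t', `|t' - t| <= N.+1%:R^-1 -> codes (nu v w t')) \/
    (forall t', `|t' - t| <= N.+1%:R^-1 -> codes (- nu v w t')).
Proof.
move=> vw hs.
pose P (sgn : R * R -> R * R) (N : nat) t :=
  forall t', `|t' - t| <= N.+1%:R^-1 -> codes (sgn (nu v w t')).
have mono sgn i j t : (i <= j)%N -> P sgn i t -> P sgn j t.
  move=> ij h t' ht'; apply: h; apply: (le_trans ht').
  by rewrite lef_pV2 ?posrE ?ltr0n // ler_nat.
have loc (sgn : R * R -> R * R) (t : R) : (\forall t' \near t, codes (sgn (nu v w t'))) ->
    exists N, \forall t' \near (t : R), P sgn N t'.
  move=> /nbhs_ballP[eps /= eps0 h].
  have [|k] := @ltr_add_invr R 0 (eps / 2); first by rewrite divr_gt0.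
  rewrite add0r => hk; exists k; apply/nbhs_ballP; exists (eps / 2).
    by rewrite /= divr_gt0.
  move=> t1; rewrite -ball_normE /= => h1 t' h2; apply: h; rewrite -ball_normE /=.
  have := le_lt_trans h2 hk; have := ler_distD t1 t t'; rewrite [`|t1 - t'|]distrC; lra.
have [||N HN] := @compact_uniform R `[0, 1]%classic
    (fun N t => P id N t \/ P -%R N t) (@segment_compact R 0 1).
- by move=> i j t ij [h|h]; [left|right]; exact: mono h.
- move=> t; rewrite /= in_itv /= => t01.
  have nt0 : nu v w t <> 0 by exact: nu_neq0.
  have nt0' : - nu v w t <> 0 by move=> /eqP; rewrite oppr_eq0 => /eqP.
  case: (nu_some vw (hs t t01)) => ct.
    have [n hn] := loc id t (@nu_continuous v w t _ (codes_near nt0 ct)).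
    by exists n; apply: filterS hn => t' h; left.
  have cN : continuous (fun t => - nu v w t).
    by move=> t'; apply: cvgN; exact: nu_continuous.
  have [n hn] := loc -%R t (cN t _ (codes_near nt0' ct)).
  by exists n; apply: filterS hn => t' h; right.
by exists N => t t01; apply: HN; rewrite /= in_itv.
Qed.

(** * Districts and cones as connected components *)

Context (K : set (homeo T T)).
Hypothesis K_act : forall g, K g <-> exists u, g = act s p u.

Lemma expansive_elementsP u :
  expansive_elements d K (act s p u) <-> disc_expansive (line u).
Proof.
split=> [[_ /expansiveP]//|hu]; split; last exact/expansiveP.
by apply/K_act; exists u.
Qed.

Notation strict_chain := (chain d K (strict_arrow d)).

(** Walk along a grid on the segment, keeping the last vector [u] of the chain and a side that has
    coded ever since [u]. When the next cell is coded on the other side, both sides code at the grid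
    point between, which thus gives an expansive vector and becomes the new [u]. *)
Lemma seg_chain v w : disc_expansive (line w) -> v <> 0 -> ~ opposite v w ->
  (forall t, 0 <= t <= 1 -> some_codes (seg w v t)) ->
  strict_chain (act s p v) (act s p w).
Proof.
move=> hw v0 nopp hs; have w0 := expansive_neq0 hw.
have [vw|vw] := eqVneq (det w v) 0.
  apply: chain_one; first exact/expansive_elementsP.
  apply: cone_strict_arrow => //; left=> n n0 nw nv.
  have vw' : det v w = 0 by move: vw; rewrite /det; lia.
  have [a [b [a0 b0 ab]]] := det0_positive v0 w0 vw' nopp.
  apply: (expansive_codes hw n0); apply/eqP; rewrite eq_le nw /=.
  have a0' : 0 < a%:~R :> R by rewrite ltr0z.
  have b0' : 0 < b%:~R :> R by rewrite ltr0z.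
  by rewrite -(pmulr_rge0 _ b0') -dotMz -ab dotMz pmulr_rge0.
have [N grid] := seg_grid vw hs.
pose M := N.+1; have M0 : 0 < M%:R :> R by rewrite ltr0n.
pose pt (k : nat) : R := k%:R / M%:R.
(* [M] times the grid point at [k / M], hence a lattice vector on the same ray. *)
pose wk (k : nat) : int * int := w *~ (M%:Z - k%:Z) + v *~ k%:Z.
have ptS k : pt k.+1 = pt k + M%:R^-1 by rewrite /pt -natr1 mulrDl mul1r.
have pt0 k : 0 <= pt k by rewrite divr_ge0 ?ler0n.
have ptM : pt M = 1 by rewrite /pt divff // gt_eqF.
have wkE k : lat (wk k) = (M%:R * (seg w v (pt k)).1, M%:R * (seg w v (pt k)).2).
  have -> : wk k = (w.1 * (M%:Z - k%:Z) + v.1 * k%:Z, w.2 * (M%:Z - k%:Z) + v.2 * k%:Z).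
    by rewrite [LHS]surjective_pairing /= !(raddfMz fst) !(raddfMz snd) !mulrzz.
  rewrite /lat /seg /pt /= !intrD !intrM !intrB -[M%:Z%:~R]/(M%:R : R) -[k%:Z%:~R]/(k%:R : R).
  by congr pair; field; rewrite gt_eqF.
pose covered (a b : R) := (forall t, a <= t <= b -> codes (nu v w t)) \/
  (forall t, a <= t <= b -> codes (- nu v w t)).
have reach k : (k <= M)%N -> exists u a l, [/\ 0 <= a <= pt k, 0 < l,
    lat u = (l * (seg w v a).1, l * (seg w v a).2),
    disc_expansive (line u) /\ (u = w \/ strict_chain (act s p u) (act s p w)) &
    covered a (pt k)].
  elim: k => [_|k ih kM].
    have pt00 : pt 0 = 0 by rewrite /pt mul0r.
    exists w, 0, 1; split; rewrite ?pt00 ?lexx ?ltr01 //; [|by split; [|left]|].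
      by rewrite /seg subr0 !mul0r !addr0 !mul1r.
    have t01 : 0 <= (0 : R) <= 1 by rewrite lexx ler01.
    have [h|h] := nu_some vw (hs 0 t01); [left|right] => t /le_anti <- //.
  have [u [a [l [/andP[a0 ak] l0 uE [hu ru] cov]]]] := ih (ltnW kM).
  have pk1 : pt k <= 1.
    by rewrite -ptM /pt ler_pM2r ?invr_gt0 // ler_nat ltnW.
  have near_pt t : pt k <= t <= pt k.+1 -> `|t - pt k| <= N.+1%:R^-1.
    by rewrite ptS => /andP[h1 h2]; rewrite ger0_norm ?subr_ge0 // lerBlDl.
  have pk : 0 <= pt k <= 1 by rewrite pt0.
  have step : covered (pt k) (pt k.+1).
    by have [h|h] := grid (pt k) pk; [left|right] => t /near_pt/h.
  have extend (Q : R -> Prop) : (forall t, a <= t <= pt k -> Q t) ->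
      (forall t, pt k <= t <= pt k.+1 -> Q t) -> forall t, a <= t <= pt k.+1 -> Q t.
    move=> h1 h2 t /andP[at1 t1]; have [tk|tk] := leP t (pt k).
      by apply: h1; rewrite at1.
    by apply: h2; rewrite ltW.
  have kk : pt k <= pt k <= pt k.+1 by rewrite lexx ptS lerDl invr_ge0 ler0n.
  have akk : a <= pt k <= pt k by rewrite ak lexx.
  have a_ok : 0 <= a <= pt k.+1 by rewrite a0 (le_trans ak) //; case/andP: kk.
  have change : both_codes (seg w v (pt k)) -> covered (pt k) (pt k.+1) ->
      exists u a l, [/\ 0 <= a <= pt k.+1, 0 < l,
      lat u = (l * (seg w v a).1, l * (seg w v a).2),
      disc_expansive (line u) /\ (u = w \/ strict_chain (act s p u) (act s p w)) &
      covered a (pt k.+1)].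
    move=> bk stp; exists (wk k), (pt k), M%:R; split=> //.
      by rewrite pt0; case/andP: kk.
    have hk : disc_expansive (line (wk k)).
      by apply/both_codesP; rewrite wkE; exact: both_codes_scale.
    split=> //; right.
    have ar : strict_arrow d (act s p (wk k)) (act s p u).
      apply: (cone_strict_arrow hu (expansive_neq0 hk)).
        exact: (seg_not_opposite vw l0 M0 uE (wkE k)).
      exact: (nu_cone vw l0 M0 ak uE (wkE k) hu cov).
    case: ru => [uw|ru]; first by apply: chain_one; [exact/expansive_elementsP|rewrite -uw].
    by apply: chain_cons ru => //; exact/expansive_elementsP.
  case: cov step => hcov [hstep|hstep].
  - exists u, a, l; split=> //; left; exact: extend hcov hstep.
  - apply: change; last by right.
    by apply: (nu_both vw); [exact: hcov|exact: hstep].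
  - apply: change; last by left.
    by apply: (nu_both vw); [exact: hstep|exact: hcov].
  - exists u, a, l; split=> //; right; exact: extend hcov hstep.
have [u [a [l [/andP[a0 a1] l0 uE [hu ru] cov]]]] := reach M (leqnn M).
rewrite ptM in a1 cov.
have vE : lat v = (1 * (seg w v 1).1, 1 * (seg w v 1).2).
  by rewrite /seg subrr !mul0r !add0r !mul1r.
have ar : strict_arrow d (act s p v) (act s p u).
  apply: (cone_strict_arrow hu v0).
    exact: (seg_not_opposite vw l0 ltr01 uE vE).
  exact: (nu_cone vw l0 ltr01 a1 uE vE hu cov).
case: ru => [uw|ru]; first by apply: chain_one; [exact/expansive_elementsP|rewrite -uw].
by apply: chain_cons ru => //; exact/expansive_elementsP.
Qed.

Lemma both_some : both_codes `<=` some_codes.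
Proof. by move=> e [e0 [c1 _]]; split=> //; left. Qed.

Lemma strict_arrow_component v w : strict_arrow d (act s p v) (act s p w) ->
  connected_component some_codes (lat w) (lat v).
Proof.
move=> /strict_arrow_cone[hw v0 nopp hc]; apply: segment_component => t t01.
exact: cone_seg.
Qed.

Lemma strict_district_component v w : disc_expansive (line w) ->
  strict_district d K (act s p w) (act s p v) <->
  connected_component some_codes (lat w) (lat v).
Proof.
move=> hw; split=> [[_ h]|comp].
  suff: forall u, act s p v = act s p u -> connected_component some_codes (lat w) (lat u).
    exact.
  move: (act s p v) h; apply: chain_ind => [psi _ arr u psiE|].
    by apply: strict_arrow_component; rewrite -psiE.
  move=> psi rho [/K_act[u' ->] _] arr ih u psiE.
  apply: (connected_component_trans (ih u' erefl)).
  by apply: strict_arrow_component; rewrite -psiE.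
have w0 := expansive_neq0 hw; split; first by apply/K_act; exists v.
have v0 : v <> 0.
  move=> v0; have [] := connected_component_sub comp.
  by rewrite v0 /lat.
have [opp|nopp] := pselect (opposite v w); last first.
  by apply: seg_chain => // t; exact: some_codes_seg.
(* A detour through [u]: off the line of [w] and [v], it is opposite to neither, so both legs are
   segments avoiding 0. *)
have [u [wu hu cu]] := transverse_neighbour hw.
have u0 := expansive_neq0 hu.
have [a [b [a0 b0 ab]]] := opp.
have e1 : v.1 * a + w.1 * b = 0.
  by have := congr1 fst ab; rewrite /= !(raddfMz fst) !mulrzz.
have e2 : v.2 * a + w.2 * b = 0.
  by have := congr1 snd ab; rewrite /= !(raddfMz snd) !mulrzz.
have ar : strict_arrow d (act s p u) (act s p w).
  apply: cone_strict_arrow => //; last by left.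
  move=> [a' [b' [a0' b0' ab']]]; move/eqP: wu; apply.
  have f1 : u.1 * a' + w.1 * b' = 0.
    by have := congr1 fst ab'; rewrite /= !(raddfMz fst) !mulrzz.
  have f2 : u.2 * a' + w.2 * b' = 0.
    by have := congr1 snd ab'; rewrite /= !(raddfMz snd) !mulrzz.
  have : det w u * a' = 0.
    transitivity (w.1 * (u.2 * a' + w.2 * b') - w.2 * (u.1 * a' + w.1 * b')).
      by rewrite /det; ring.
    by rewrite f1 f2; ring.
  by move/eqP; rewrite mulf_eq0 => /orP[/eqP//|/eqP a'0]; rewrite a'0 ltxx in a0'.
have nopp' : ~ opposite v u.
  move=> [a' [b' [a0' b0' ab']]]; move/eqP: wu; apply.
  have f1 : v.1 * a' + u.1 * b' = 0.
    by have := congr1 fst ab'; rewrite /= !(raddfMz fst) !mulrzz.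
  have f2 : v.2 * a' + u.2 * b' = 0.
    by have := congr1 snd ab'; rewrite /= !(raddfMz snd) !mulrzz.
  have : det w u * (b * b') = 0.
    transitivity ((w.1 * b) * (v.2 * a' + u.2 * b') - (w.2 * b) * (v.1 * a' + u.1 * b')
      - a' * (v.2 * (v.1 * a + w.1 * b) - v.1 * (v.2 * a + w.2 * b))).
      by rewrite /det; ring.
    by rewrite f1 f2 e1 e2; ring.
  move/eqP; rewrite !mulf_eq0 => /orP[/eqP//|/orP[] /eqP h].
    by rewrite h ltxx in b0.
  by rewrite h ltxx in b0'.
have comp_u := connected_component_sym (strict_arrow_component ar).
apply: chain_rcons ar; first exact/expansive_elementsP.
apply: seg_chain => // t; apply: some_codes_seg => //.
exact: connected_component_trans comp.
Qed.

(** One step suffices here: a component yields both cones at once, and [LR_cones] excludes opposite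
    vectors, so the segment from [w] to [v] leads back into the component. *)
Lemma cone_interior_component v w : disc_expansive (line w) ->
  cone_interior d K (cone K (act s p w)) (act s p v) <->
  connected_component both_codes (lat w) (lat v).
Proof.
move=> hw; split=> [[[Kv lr] /expansive_elementsP hv]|comp].
  have [nopp c1 c2] := LR_cones lr hw hv.
  apply: segment_component => t t01.
  exact: (cones_seg hw (expansive_neq0 hv) nopp t01 c1 c2).
have hv : disc_expansive (line v) by apply/both_codesP/(connected_component_sub comp).
split; last exact/expansive_elementsP.
split; first by apply/K_act; exists v.
apply: ess_weakly_of_cones => // _; first exact: codes_component_cone.
exact/codes_component_cone/connected_component_sym.
Qed.

End Coding.

(** * Application to the subshift *)

Lemma subtype_compact (S : topologicalType) (B : set S) : compact B -> compact [set: B].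
Proof.
move=> /compact_near_coveringP cB; apply/compact_near_coveringP => J F P FF h.
have := cB J F (fun i a => forall Ba : a \in B, P i (exist _ a Ba)) FF.
case/(_ _)/Wrap => [a Ba|].
  have [[U V] /= [[_ [[W oW <-] Wx] WU] FV] UV] := h (exist _ a (mem_set Ba)) I.
  exists (W, V); first by split=> //; exact: open_nbhs_nbhs.
  by move=> [a' i] /= [Wa' Vi] Ba'; apply: (UV (exist _ a' Ba', i)); split=> //; exact: WU.
by apply: filterS => i hi [a Ba] _; exact: hi (set_mem Ba) Ba.
Qed.

Theorem theorem11p13 (R : realType) (A : finType) (X : subshift A)
    (d : X -> X -> R) (d_compatible : compatible_metric d)
    (X_infinite : infinite_set (X : set (fullshift A)))
    (phi : homeo X X) (phi_aut : automorphism (sigma X) phi)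
    (K : set (homeo X X))
    (K_gen : K = generated_subgroup [set sigma X; phi]) :
  (forall L : set (int * int),
    (exists2 C : set (R * R),
        component (plane_right d (sigma X) phi `&` plane_left d (sigma X) phi) C &
        L = lattice_points C) <->
    (exists2 C : set (homeo X X),
        is_cone d K C & L = Lambda (sigma X) phi (cone_interior d K C))) /\
  (forall L : set (int * int),
    (exists D : set (R * R),
      [/\ component (plane_right d (sigma X) phi `|` plane_left d (sigma X) phi) D,
          D `&` (plane_right d (sigma X) phi `&` plane_left d (sigma X) phi) !=set0 &
          L = lattice_points D]) <->
    (exists D D0 : set (homeo X X),
      district_interior d K D D0 /\ L = Lambda (sigma X) phi D0)).
Proof.
have cX : compact [set: X].
  apply: subtype_compact.
  exact: (subclosed_compact (@subshift_closed _ X) (@fullshift_compact A)).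
have infX : infinite_set [set: X].
  move=> finX; apply: X_infinite.
  have -> : (X : set (fullshift A)) = (fun x : X => \val x) @` setT.
    by apply/seteqP; split=> [a /mem_set Xa|_ [x _ <-]]; [exists (exist _ a Xa)|exact: set_valP].
  exact: finite_image.
pose c (x : X) := \val x 0.
have c_lc : locally_constant c by exact: subshift_coordinate_lc.
have c_gen x y : (forall j, c (expgz (sigma X) j x) = c (expgz (sigma X) j y)) -> x = y.
  by move=> xy; apply/val_inj/funext => j; have := xy j; rewrite /c !sigma_expgz add0r.
have K_act := generated_act phi_aut K_gen.
rewrite (plane_both cX c_lc c_gen phi_aut d_compatible).
rewrite (plane_some cX c_lc c_gen phi_aut d_compatible).
have point := @lattice_point_component R X A c (sigma X) phi cX c_lc c_gen phi_aut infX.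
have expE := expansive_elementsP cX c_lc c_gen phi_aut d_compatible K_act.
have bothE := @both_codesP R X A c (sigma X) phi cX c_lc c_gen phi_aut infX.
split=> L; split.
- move=> [C [e he <-] ->]; have [w hw we] := point e he.
  exists (cone K (act (sigma X) phi w)).
    by exists (act (sigma X) phi w) => //; exact/expE.
  rewrite (same_connected_component we); apply/seteqP; split=> u.
    by move/(cone_interior_component cX c_lc c_gen phi_aut d_compatible infX K_act u hw).
  by move/(cone_interior_component cX c_lc c_gen phi_aut d_compatible infX K_act u hw).
- move=> [C [tau tauE ->] ->]; have [/K_act[w tw] _] := tauE.
  rewrite tw in tauE *; have hw := iffLR (expE w) tauE.
  exists (connected_component (both_codes (R := R) c (sigma X) phi) (lat w)).
    by exists (lat w) => //; exact/bothE.
  apply/seteqP; split=> u.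
    by move/(cone_interior_component cX c_lc c_gen phi_aut d_compatible infX K_act u hw).
  by move/(cone_interior_component cX c_lc c_gen phi_aut d_compatible infX K_act u hw).
(* The base point [e] of the component need not lie in [both_codes]; the nonempty intersection
   supplies [z], from which a lattice point is reached. *)
- move=> [D [[e he <-] [z [ez bz]] ->]]; have [w hw we] := point z bz.
  have ew := connected_component_trans ez (connected_component_mono (@both_some _ _ _ _ _ _) we).
  exists (district d K (act (sigma X) phi w)), (strict_district d K (act (sigma X) phi w)).
  split; first by exists (act (sigma X) phi w); split=> //; exact/expE.
  rewrite (same_connected_component ew); apply/seteqP; split=> u.
    by move/(strict_district_component cX c_lc c_gen phi_aut d_compatible infX K_act u hw).
  by move/(strict_district_component cX c_lc c_gen phi_aut d_compatible infX K_act u hw).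
- move=> [D [D0 [[tau [tauE _ ->]] ->]]]; have [/K_act[w tw] _] := tauE.
  rewrite tw in tauE *; have hw := iffLR (expE w) tauE.
  exists (connected_component (some_codes (R := R) c (sigma X) phi) (lat w)).
  have bw : both_codes (R := R) c (sigma X) phi (lat w) by exact/bothE.
  have sw := both_some bw.
  split; first by exists (lat w).
    by exists (lat w); split=> //; exact: connected_component_refl.
  apply/seteqP; split=> u.
    by move/(strict_district_component cX c_lc c_gen phi_aut d_compatible infX K_act u hw).
  by move/(strict_district_component cX c_lc c_gen phi_aut d_compatible infX K_act u hw).
Qed.
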